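(* Any four-dimensional generalised Einstein Riemannian Lie algebra $(\mathfrak g,H,\mathcal G_g,\delta)$ is isomorphic to one of the following four-dimensional generalised Einstein Riemannian Lie algebras: (i) $(\mathbb R^4,H=0,\mathcal G_g,\delta)$ with $\mathbb R^4$ Abelian, $g$ an arbitrary Riemannian metric and $\delta\in E^*$ arbitrary; (ii) $(\mathfrak e(2)\oplus\mathbb R,H=0,\mathcal G_g,\delta)$ such that $\mathfrak e(2)\oplus\mathbb R$ admits an orthonormal basis $(e_1,\dots,e_4)$ whose only non-zero Lie brackets (up to anti-symmetry) are $[e_3,e_1]=a\,e_2$, $[e_3,e_2]=-a\,e_1$ for some $a>0$, and $\delta\in\mathrm{span}(e_3,e_4,e^3,e^4)$ (that is, $\delta(e_1)=\delta(e_2)=\delta(e^1)=\delta(e^2)=0$); (iii) $(\mathfrak{so}(3)\oplus\mathbb R,H,\mathcal G_g,\delta)$ such that there exist $a\in\mathbb R\setminus\{0\}$, $b\in\mathbb R$, $\epsilon\in\{-1,1\}$ and an orthonormal basis $(e_1,\dots,e_4)$ with $H=a\,e^{123}$, the only non-zero Lie brackets (up to anti-symmetry) being $$[e_1,e_2]=\epsilon a\,e_3,\ [e_2,e_3]=\epsilon a\,e_1,\ [e_3,e_1]=\epsilon a\,e_2,\ [e_3,e_4]=b\,e_2,\ [e_4,e_2]=b\,e_3,$$ and moreover: if $b\neq0$, then $\delta(e_1)=-\epsilon\,\delta(e^1)$ and $\delta(\mathrm{span}(e_2,e_3,e^2,e^3))=0$; if $b=0$, then $\delta(e_i)=-\epsilon\,\delta(e^i)$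 for $i=1,2,3$.
   Context: Let $\mathfrak g$ be a finite-dimensional real Lie algebra. A generalised pseudo-Riemannian metric on $\mathfrak g$ is a pair $(H,\mathcal G_g)$ where $H\in\Lambda^3\mathfrak g^*$ is closed for the Chevalley–Eilenberg differential (normalised by $d\alpha(X,Y)=-\alpha([X,Y])$), $g$ is a non-degenerate symmetric bilinear form on $\mathfrak g$, and $\mathcal G_g$ is the endomorphism of $E=\mathfrak g\oplus\mathfrak g^*$ given by $\mathcal G_g(X+\xi)=\xi^\sharp+X^\flat$, with $X^\flat=g(X,\cdot)$ and $\sharp=\flat^{-1}$; it is called Riemannian if $g$ is positive definite. Let $E_\pm=\{X\pm X^\flat\mid X\in\mathfrak g\}$ be the $\pm1$-eigenspaces of $\mathcal G_g$ and $\pi_\pm=\frac12(\mathrm{id}\pm\mathcal G_g):E\to E_\pm$. The $H$-twisted Dorfman bracket on $E$ is $[X+\xi,Y+\eta]_H=[X,Y]+d\eta(X,\cdot)-d\xi(Y,\cdot)+H(X,Y,\cdot)$. A divergence operator is an element $\delta\in E^*$. For $u\in E_+$, $v\in E_-$ put $\Gamma_u=\pi_+\circ[u,\cdot]_H|_{E_-}:E_-\to E_+$ and $\Gamma_v=\pi_-\circ[v,\cdot]_H|_{E_+}:E_+\to E_-$. The generalised Ricci curvatures of $(\mathcal G_g,\delta)$ are, by a known result taken here as definition, $\mathcal{RC}^+(v,u)=-\mathrm{tr}(\Gamma_v\circ\Gamma_u)+\delta(\pi_+[v,u]_H)$ and $\mathcal{RC}^-(u,v)=-\mathrm{tr}(\Gamma_v\circ\Gamma_u)+\delta(\pi_-[u,v]_H)$.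 The quadruple $(\mathfrak g,H,\mathcal G_g,\delta)$ is generalised Einstein (a generalised Einstein Riemannian Lie algebra when $g$ is positive definite) if $\mathcal{RC}^+=0$ and $\mathcal{RC}^-=0$ (for all $u\in E_+$, $v\in E_-$). Two such quadruples are isomorphic if there is a Lie algebra isomorphism identifying the metrics $g$, the three-forms $H$ and (via the induced isomorphism of $\mathfrak g\oplus\mathfrak g^*$) the divergences $\delta$. $(e^1,\dots,e^4)$ is the dual basis, $e^{123}=e^1\wedge e^2\wedge e^3$. $\mathfrak e(2)$ is the Lie algebra of the Euclidean motion group of the plane. *)

(* Defs.v *)
From HB Require Import structures.
From mathcomp Require Import all_boot all_order all_algebra.
From mathcomp Require Import reals ring.

Set Implicit Arguments.
Unset Strict Implicit.
Unset Printing Implicit Defensive.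

Import Order.TTheory GRing.Theory Num.Theory.
Local Open Scope ring_scope.

HB.mixin Record Vector_isLieAlgebra (K : fieldType) (V : Type)
    of Vector K V := {
  lie : V -> V -> V;
  lie_is_linear_left : forall y, linear (lie ^~ y);
  lie_is_linear_right : forall x, linear (lie x);
  liexx : forall x, lie x x = 0;
  lie_jacobi : forall x y z,
    lie x (lie y z) + lie y (lie z x) + lie z (lie x y) = 0
}.

#[short(type="lieAlgType")]
HB.structure Definition LieAlgebra (K : fieldType) :=
  {V of Vector_isLieAlgebra K V & Vector K V}.

Section AbelianLieAlgebra.
Variables (K : fieldType) (V : vectType K).

Definition abelian_lie : Type := V.
HB.instance Definition _ := Vector.on abelian_lie.

Definition lie0 (_ _ : abelian_lie) : abelian_lie := 0.

Fact lie0_is_linear_left y : linear (lie0 ^~ y).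
Proof. by move=> a x x'; rewrite /lie0 scaler0 addr0. Qed.
Fact lie0_is_linear_right x : linear (lie0 x).
Proof. by move=> a y y'; rewrite /lie0 scaler0 addr0. Qed.
Fact lie0xx x : lie0 x x = 0.
Proof. by []. Qed.
Fact lie0_jacobi x y z :
  lie0 x (lie0 y z) + lie0 y (lie0 z x) + lie0 z (lie0 x y) = 0.
Proof. by rewrite /lie0 !addr0. Qed.

HB.instance Definition _ := Vector_isLieAlgebra.Build K abelian_lie
  lie0_is_linear_left lie0_is_linear_right lie0xx lie0_jacobi.
End AbelianLieAlgebra.

Section DirectSumLieAlgebra.
Variables (K : fieldType) (g h : lieAlgType K).

Definition lie_pair (x y : g * h) : g * h := (lie x.1 y.1, lie x.2 y.2).

Fact lie_pair_is_linear_left y : linear (lie_pair ^~ y).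
Proof. by move=> a x x'; rewrite /lie_pair /= !lie_is_linear_left. Qed.
Fact lie_pair_is_linear_right x : linear (lie_pair x).
Proof. by move=> a y y'; rewrite /lie_pair /= !lie_is_linear_right. Qed.
Fact lie_pairxx x : lie_pair x x = 0.
Proof. by rewrite /lie_pair !liexx. Qed.
Fact lie_pair_jacobi x y z :
  lie_pair x (lie_pair y z) + lie_pair y (lie_pair z x)
    + lie_pair z (lie_pair x y) = 0.
Proof. by congr (_, _); apply: lie_jacobi. Qed.

HB.instance Definition _ := Vector_isLieAlgebra.Build K (g * h)%type
  lie_pair_is_linear_left lie_pair_is_linear_right lie_pairxx lie_pair_jacobi.
End DirectSumLieAlgebra.

Section MatrixLieAlgebra.
Variables (K : fieldType) (n : nat).
Implicit Types A B C : 'M[K]_n.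

Definition mxcomm A B := A *m B - B *m A.

Variable U : {vspace 'M[K]_n}.
Hypothesis mxcommU : forall A B, A \in U -> B \in U -> mxcomm A B \in U.

Definition sub_mxcomm (x y : subvs_of U) : subvs_of U :=
  vsproj U (mxcomm (vsval x) (vsval y)).

Fact vsval_sub_mxcomm x y :
  vsval (sub_mxcomm x y) = mxcomm (vsval x) (vsval y).
Proof. by rewrite vsprojK // mxcommU ?subvsP. Qed.

Fact sub_mxcomm_is_linear_left y : linear (sub_mxcomm ^~ y).
Proof.
move=> a x x'; apply: subvs_inj; rewrite linearP /= !vsval_sub_mxcomm linearP /=.
rewrite /mxcomm mulmxDl mulmxDr -scalemxAl -scalemxAr scalerBr opprD.
by rewrite addrACA.
Qed.

Fact sub_mxcomm_is_linear_right x : linear (sub_mxcomm x).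
Proof.
move=> a y y'; apply: subvs_inj; rewrite linearP /= !vsval_sub_mxcomm linearP /=.
rewrite /mxcomm mulmxDl mulmxDr -scalemxAl -scalemxAr scalerBr opprD.
by rewrite addrACA.
Qed.

Fact sub_mxcommxx x : sub_mxcomm x x = 0.
Proof. by apply: subvs_inj; rewrite vsval_sub_mxcomm /mxcomm subrr. Qed.

Fact sub_mxcomm_jacobi x y z :
  sub_mxcomm x (sub_mxcomm y z) + sub_mxcomm y (sub_mxcomm z x)
    + sub_mxcomm z (sub_mxcomm x y) = 0.
Proof.
apply: subvs_inj; rewrite !linearD /= !vsval_sub_mxcomm.
move: (vsval x) (vsval y) (vsval z) => A B C; rewrite /mxcomm.
rewrite !mulmxBr !mulmxBl !mulmxA.
move: (A *m B *m C) (A *m C *m B) (B *m C *m A) (B *m A *m C) (C *m A *m B)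
  (C *m B *m A) => p q r s t u.
by apply/matrixP => i j; rewrite !mxE; ring.
Qed.
End MatrixLieAlgebra.

Section ConcreteLieAlgebras.
Variables (R : realType) (n : nat).

Definition symmetrizer (A : 'M[R]_n) := A + A^T.

Fact symmetrizer_is_linear : linear symmetrizer.
Proof. by move=> a A B; rewrite /symmetrizer linearP scalerDr addrACA. Qed.
HB.instance Definition _ :=
  GRing.isLinear.Build R _ _ _ symmetrizer symmetrizer_is_linear.

Definition so_space : {vspace 'M[R]_n} := lker (linfun symmetrizer).

Fact mem_so A : (A \in so_space) = (A^T == - A).
Proof. by rewrite memv_ker lfunE /= /symmetrizer addrC addr_eq0. Qed.

Fact mxcomm_so A B :
  A \in so_space -> B \in so_space -> mxcomm A B \in so_space.
Proof.
rewrite !mem_so => /eqP tA /eqP tB; apply/eqP.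
by rewrite /mxcomm linearB /= !trmx_mul tA tB !mulNmx !mulmxN !opprK opprB.
Qed.

Definition so : Type := subvs_of so_space.
HB.instance Definition _ := Vector.on so.
HB.instance Definition _ := Vector_isLieAlgebra.Build R so
  (sub_mxcomm_is_linear_left mxcomm_so) (sub_mxcomm_is_linear_right mxcomm_so)
  (sub_mxcommxx mxcomm_so) (sub_mxcomm_jacobi mxcomm_so).

(* The infinitesimal motion x |-> A x + v of R^n, A skew-symmetric, is the
   matrix block_mx A v 0 0. *)
Definition euc_defect (M : 'M[R]_(n + 1)) :=
  (symmetrizer (ulsubmx M), dsubmx M).

Fact euc_defect_is_linear : linear euc_defect.
Proof.
move=> a A B; rewrite /euc_defect /ulsubmx.
by congr (_, _); rewrite !linearP.
Qed.
HB.instance Definition _ :=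
  GRing.isLinear.Build R _ _ _ euc_defect euc_defect_is_linear.

Definition euc_space : {vspace 'M[R]_(n + 1)} := lker (linfun euc_defect).

Fact mem_euc M :
  (M \in euc_space) = ((ulsubmx M)^T == - ulsubmx M) && (dsubmx M == 0).
Proof. by rewrite memv_ker lfunE /= xpair_eqE /symmetrizer addrC addr_eq0. Qed.

Fact mxcomm_euc A B :
  A \in euc_space -> B \in euc_space -> mxcomm A B \in euc_space.
Proof.
rewrite !mem_euc => /andP[/eqP tA /eqP dA] /andP[/eqP tB /eqP dB].
have blk (M : 'M[R]_(n + 1)) : dsubmx M = 0 ->
    M = block_mx (ulsubmx M) (ursubmx M) 0 0.
  by move=> dM; rewrite -{1}[M]submxK /dlsubmx /drsubmx dM !linear0.
rewrite (blk A dA) (blk B dB) /mxcomm !mulmx_block !mulmx0 !mul0mx !addr0.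
rewrite opp_block_mx add_block_mx block_mxKul.
apply/andP; split.
  rewrite linearB /= !trmx_mul tA tB !mulNmx !mulmxN !opprK opprB.
  exact: eqxx.
by rewrite block_mxEv col_mxKd !subr0 row_mx0.
Qed.

Definition euc : Type := subvs_of euc_space.
HB.instance Definition _ := Vector.on euc.
HB.instance Definition _ := Vector_isLieAlgebra.Build R euc
  (sub_mxcomm_is_linear_left mxcomm_euc)
  (sub_mxcomm_is_linear_right mxcomm_euc)
  (sub_mxcommxx mxcomm_euc) (sub_mxcomm_jacobi mxcomm_euc).
End ConcreteLieAlgebras.

Definition dual (R : realType) (g : vectType R) : vectType R := 'Hom(g, R^o).

Definition gtangent (R : realType) (g : vectType R) : vectType R :=
  (g * dual g)%type.

Definition of_vect (R : realType) (g : vectType R) (X : g) : gtangent g :=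
  (X, 0).
Definition of_covect (R : realType) (g : vectType R) (xi : dual g) :
    gtangent g :=
  (0, xi).

Section Forms.
Variables (R : realType) (g : lieAlgType R).

Record three_form := ThreeForm {
  three_form_fun :> g -> g -> g -> R;
  three_form_linear1 : forall Y Z, scalar (fun X => three_form_fun X Y Z);
  three_form_linear2 : forall X Z, scalar (fun Y => three_form_fun X Y Z);
  three_form_linear3 : forall X Y, scalar (fun Z => three_form_fun X Y Z);
  three_form_alt12 : forall X Z, three_form_fun X X Z = 0;
  three_form_alt23 : forall X Y, three_form_fun X Y Y = 0
}.

(* Chevalley-Eilenberg differential
     dw(X_0, .., X_k) = \sum_(i < j) (-1)^(i + j)
       w([X_i, X_j], X_0, .., ^X_i, .., ^X_j, .., X_k)
   for k = 1 and k = 3; ce1 xi X is the covector d(xi)(X, .). *)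
Definition ce1 (xi : dual g) (X : g) : dual g :=
  linfun (fun Y => - xi (lie X Y) : R^o).

Definition ce3 (w : g -> g -> g -> R) (X0 X1 X2 X3 : g) : R :=
  - w (lie X0 X1) X2 X3 + w (lie X0 X2) X1 X3 - w (lie X0 X3) X1 X2
  - w (lie X1 X2) X0 X3 + w (lie X1 X3) X0 X2 - w (lie X2 X3) X0 X1.

(* Determinant normalisation: e^123 (e_1, e_2, e_3) = 1. *)
Definition wedge3 (a b c : dual g) (X Y Z : g) : R :=
  \det (\matrix_(i < 3, j < 3)
    ([:: a; b; c]`_i ([:: X; Y; Z]`_j) : R)).
End Forms.

Definition lftrace (K : fieldType) (V : vectType K) (f : 'End(V)) : K :=
  \tr (passmx.mxof (vbasis {:V}) (vbasis {:V}) f).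

(* (H, G_g, delta); G_g is determined by g, so H (torsion) and g (metric) are
   stored. *)
Record gen_data (R : realType) (g : lieAlgType R) := GenData {
  torsion : three_form g;
  torsion_closed : forall X0 X1 X2 X3, ce3 torsion X0 X1 X2 X3 = 0;
  metric : {symmetric g};
  metric_nondegenerate : nondegenerate metric;
  divergence : dual (gtangent g)
}.

Section Curvature.
Variables (R : realType) (g : lieAlgType R) (Q : gen_data g).

Local Notation E := (gtangent g).

Definition riemannian := forall X : g, X != 0 -> 0 < metric Q X X.

Definition flat : 'Hom(g, dual g) :=
  linfun (fun X => linfun (fun Y => metric Q X Y : R^o)).
Definition sharp : 'Hom(dual g, g) := (flat^-1)%VF.

Definition gen_metric : 'End(E) := linfun (fun u : E => (sharp u.2, flat u.1)).

Definition Eplus : {vspace E} := limg (linfun (fun X : g => (X, flat X))).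
Definition Eminus : {vspace E} := limg (linfun (fun X : g => (X, - flat X))).

Definition pi_plus : 'End(E) := 2^-1 *: (\1 + gen_metric)%VF.
Definition pi_minus : 'End(E) := 2^-1 *: (\1 - gen_metric)%VF.

Definition dorfman (u v : E) : E :=
  (lie u.1 v.1,
   ce1 v.2 u.1 - ce1 u.2 v.1 + linfun (fun Z => torsion Q u.1 v.1 Z : R^o)).

(* vsproj only retypes: the image of pi_plus is Eplus, that of pi_minus is
   Eminus. *)
Definition Gamma_plus (u : subvs_of Eplus) :
    'Hom(subvs_of Eminus, subvs_of Eplus) :=
  linfun (fun w => vsproj Eplus (pi_plus (dorfman (vsval u) (vsval w)))).
Definition Gamma_minus (v : subvs_of Eminus) :
    'Hom(subvs_of Eplus, subvs_of Eminus) :=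
  linfun (fun w => vsproj Eminus (pi_minus (dorfman (vsval v) (vsval w)))).

Definition RicciPlus (v : subvs_of Eminus) (u : subvs_of Eplus) : R :=
  - lftrace (Gamma_minus v \o Gamma_plus u)%VF
  + divergence Q (pi_plus (dorfman (vsval v) (vsval u))).
Definition RicciMinus (u : subvs_of Eplus) (v : subvs_of Eminus) : R :=
  - lftrace (Gamma_minus v \o Gamma_plus u)%VF
  + divergence Q (pi_minus (dorfman (vsval u) (vsval v))).

Definition gen_einstein :=
  (forall v u, RicciPlus v u = 0) /\ (forall u v, RicciMinus u v = 0).

Definition gen_einstein_riemannian4 :=
  [/\ \dim {:g} = 4, riemannian & gen_einstein].
End Curvature.

Definition isomorphic (R : realType) (g h : lieAlgType R)
    (Q : gen_data g) (Q' : gen_data h) :=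
  exists2 phi : 'Hom(g, h), bijective phi &
  [/\ forall X Y, phi (lie X Y) = lie (phi X) (phi Y),
      forall X Y, metric Q' (phi X) (phi Y) = metric Q X Y,
      forall X Y Z, torsion Q' (phi X) (phi Y) (phi Z) = torsion Q X Y Z &
      forall (X : g) (xi : dual g),
        divergence Q' (phi X, (xi \o phi^-1)%VF) = divergence Q (X, xi)].

Section Families.
Variable R : realType.

Definition R4 : lieAlgType R := abelian_lie 'rV[R]_4.
Definition e2R : lieAlgType R := (euc R 2 * abelian_lie R^o)%type.
Definition so3R : lieAlgType R := (so R 3 * abelian_lie R^o)%type.

Section Bases.
Variables (g : lieAlgType R) (Q : gen_data g).

Definition orthonormal_basis (e : 4.-tuple g) : bool :=
  basis_of {:g} e && orthonormal (metric Q) e.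

Definition dual_basis (e : 4.-tuple g) (i : 'I_4) : dual g :=
  linfun (fun X => coord e i X : R^o).
End Bases.

Definition family_abelian (Q : gen_data R4) :=
  riemannian Q /\ (forall X Y Z, torsion Q X Y Z = 0).

Definition family_e2 (Q : gen_data e2R) :=
  (forall X Y Z, torsion Q X Y Z = 0) /\
  exists2 e : 4.-tuple e2R, orthonormal_basis Q e &
  exists2 a : R, 0 < a &
  let e1 := e`_0 in let e2 := e`_1 in let e3 := e`_2 in let e4 := e`_3 in
  let f1 := dual_basis e 0 in let f2 := dual_basis e 1 in
  let delta := divergence Q in
  [/\ lie e3 e1 = a *: e2,
      lie e3 e2 = - a *: e1,
      [/\ lie e1 e2 = 0, lie e1 e4 = 0, lie e2 e4 = 0 & lie e3 e4 = 0],
      delta (of_vect e1) = 0 /\ delta (of_vect e2) = 0 &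
      delta (of_covect f1) = 0 /\ delta (of_covect f2) = 0].

Definition family_so3 (Q : gen_data so3R) :=
  exists (a b eps : R) (e : 4.-tuple so3R),
  let e1 := e`_0 in let e2 := e`_1 in let e3 := e`_2 in let e4 := e`_3 in
  let f1 := dual_basis e 0 in let f2 := dual_basis e 1 in
  let f3 := dual_basis e 2 in let delta := divergence Q in
  [/\ a != 0, eps = -1 \/ eps = 1 & orthonormal_basis Q e] /\
  (forall X Y Z, torsion Q X Y Z = a * wedge3 f1 f2 f3 X Y Z) /\
  [/\ lie e1 e2 = (eps * a) *: e3,
      lie e2 e3 = (eps * a) *: e1,
      lie e3 e1 = (eps * a) *: e2 &
      [/\ lie e3 e4 = b *: e2, lie e4 e2 = b *: e3 & lie e1 e4 = 0]] /\
  (b != 0 ->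
    delta (of_vect e1) = - eps * delta (of_covect f1) /\
    {in <<[:: of_vect e2; of_vect e3; of_covect f2; of_covect f3]>>%VS,
       forall u, delta u = 0}) /\
  (b = 0 ->
    [/\ delta (of_vect e1) = - eps * delta (of_covect f1),
        delta (of_vect e2) = - eps * delta (of_covect f2) &
        delta (of_vect e3) = - eps * delta (of_covect f3)]).
End Families.

(* Main.v *)
(* In an orthonormal basis (e_i) of g with structure constants c and three-form h, put
   e_i^+ = e_i + e^i and e_i^- = e_i - e^i. Both Einstein equations read
   T i j = \sum_k P j i k * delta (e_k^+) = \sum_k Q i j k * delta (e_k^-), where P and
   Q are the mixed components of the Dorfman bracket on E = E_+ + E_- and T is quadratic
   in them. Since inner derivations of E preserve the bracket, T satisfies a Bianchi-type
   identity \sum_(i, j) T i j * P j i k = 0; pairing the first equation with T gives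
   \sum T^2 = 0, hence T = 0.

   For x orthogonal to [g, g], T(x, x) is a sum of squares, so T = 0 makes ad x skew and
   kills the contraction of H with x. Applied to the trace vector of g, this shows that
   g is unimodular; then, in dimension four, [g, g] has a nonzero orthogonal vector e_4,
   and H = a e^123. On the ideal orthogonal to e_4 write [x, y] = L (x * y) with the
   cross product and L symmetric; T = 0 says that N = tr L - 2 L has adjugate a^2. If a
   is nonzero, then N, hence L, is scalar, which is the so(3) case. If a = 0, then N has
   rank at most one, there is a second vector orthogonal to [g, g], and g is R^4 or
   e(2) + R. Once T = 0, the conditions on the divergence are linear. *)

(* The divergence is arbitrary data, so the equations have to be freed from it before anything is
   known about the bracket; positive definiteness allows this, since a vanishing sum of squares
   vanishes termwise. Everything down to unimodularity concerns arrays of structure constants in any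
   dimension. Dimension four enters through the vector e_4, through reading a three-form killed by
   e_4 as a multiple of e^123, and through the cross product on the orthogonal of e_4. The symmetry
   of L is unimodularity in disguise, and the adjugate appears because T is quadratic in N.

   The families live on fixed Lie algebras of matrices, whereas the analysis ends with an
   orthonormal basis and a bracket table. A basis of the model with the same table yields a Lie
   isomorphism, along which metric, three-form and divergence are pushed; conditions stated on a
   frame then transfer without new computation. The converse handles the three families together, as
   members of one four-parameter table of brackets and torsion. *)
From HB Require Import structures.
Require Import Defs.
From mathcomp Require Import all_boot all_order all_algebra.
From mathcomp Require Import perm reals ring lra zify.

Set Implicit Arguments.
Unset Strict Implicit.
Unset Printing Implicit Defensive.

Import Order.TTheory GRing.Theory Num.Theory.
Local Open Scope ring_scope.

(** * Structure constants and the Bianchi identity *)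

Section Arrays.
Variables (R : realFieldType) (n : nat) (c h : 'I_n -> 'I_n -> 'I_n -> R).

(* With e_i^+ = e_i + e^i and e_i^- = e_i - e^i, conn_plus j i k is the e_k^+ component
   of the Dorfman bracket of e_j^- and e_i^+, conn_minus i j k the e_k^- component of
   that of e_i^+ and e_j^-, and ricci i j the trace of Gamma_(e_j^-) o Gamma_(e_i^+). *)
Definition conn_plus j i k := (c j i k - c i k j + c k j i + h j i k) / 2.
Definition conn_minus i j k := (c i j k - c j k i + c k i j - h i j k) / 2.
Definition ricci i j := \sum_k \sum_l conn_minus k j l * conn_plus l i k.

Local Notation P := conn_plus.
Local Notation Q := conn_minus.
Local Notation T := ricci.

Hypothesis cC : forall i j k, c j i k = - c i j k.
Hypothesis hC12 : forall i j k, h j i k = - h i j k.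
Hypothesis hC23 : forall i j k, h i k j = - h i j k.
Definition jacobi_term i j k l m :=
  c i j m * c m k l + c j k m * c m i l + c k i m * c m j l.
Definition closed_term i j k l m :=
  - c i j m * h m k l + c i k m * h m j l - c i l m * h m j k
  - c j k m * h m i l + c j l m * h m i k - c k l m * h m i j.
Local Notation J := jacobi_term.
Local Notation D := closed_term.
Hypothesis jac : forall i j k l, \sum_m J i j k l m = 0.
Hypothesis dh0 : forall i j k l, \sum_m D i j k l m = 0.

(* Up to sign, the components of the Dorfman bracket on three vectors of E_+, resp.
   of E_-. *)
Definition skew_plus i j k := (c i j k + c j k i + c k i j + h i j k) / 2.
Definition skew_minus i j k := (c i j k + c j k i + c k i j - h i j k) / 2.

Local Notation E := skew_plus.
Local Notation G := skew_minus.

Lemma conn_plusC j i k : P j k i = - P j i k.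
Proof. by rewrite /P (cC k i) (cC j k) (cC j i) hC23; field. Qed.
Lemma conn_minusC i j k : Q i k j = - Q i j k.
Proof. by rewrite /Q (cC k j) (cC i k) (cC i j) hC23; field. Qed.
Lemma skew_plusC i j k : E j i k = - E i j k.
Proof. by rewrite /E (cC i j) (cC j k) (cC k i) hC12; field. Qed.
Lemma skew_minusC i j k : G j i k = - G i j k.
Proof. by rewrite /G (cC i j) (cC j k) (cC k i) hC12; field. Qed.
Lemma skew_minus_rot i j k : G j k i = G i j k.
Proof. by rewrite /G (hC23 j i k) hC12 opprK; field. Qed.

(** Oriented instances of antisymmetry: each one moves a pair of indices towards the order l, j, k,
    x, m, so iterated rewriting terminates in a normal form, where the general laws would loop. *)
Let srt l j k x m := ((cC l j, cC l k, cC l x, cC l m, cC j k, cC j x, cC j m,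
    cC k x, cC k m, cC x m),
  (hC12 l j, hC12 l k, hC12 l x, hC12 l m, hC12 j k, hC12 j x, hC12 j m,
    hC12 k x, hC12 k m, hC12 x m),
  (fun i => hC23 i l j, fun i => hC23 i l k, fun i => hC23 i l x,
    fun i => hC23 i l m, fun i => hC23 i j k, fun i => hC23 i j x,
    fun i => hC23 i j m, fun i => hC23 i k x, fun i => hC23 i k m, fun i => hC23 i x m)).

(* Components (-, -, +, +) and (-, -, -, +) of the Jacobi identity of the Dorfman
   bracket; the coefficients below combine the Jacobi identity of c with dh = 0. *)
Lemma courant_jacobi22 l j k x :
  \sum_m (- Q m l j * E m k x + G l j m * P m k x - P j k m * P l m x
    + P l k m * P j m x + Q k j m * Q x m l - Q k l m * Q x m j) = 0.
Proof.
transitivity (\sum_m 2^-1 * (J l j k x m - J l j x k m - J l k x j m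
    + J j k x l m - D l j k x m)); last first.
  by rewrite -mulr_sumr sumrB big_split /= 2!sumrB !jac dh0 !subr0 addr0 mulr0.
apply: eq_bigr => m _; rewrite /J /D.
rewrite /P /Q /E /G !(srt l j k x m).
by field.
Qed.

Lemma courant_jacobi31 j l m x :
  \sum_a (Q a j l * P m a x + Q a l m * P j a x + Q a m j * P l a x
    - G j l a * Q x a m - G l m a * Q x a j - G m j a * Q x a l) = 0.
Proof.
transitivity (\sum_a 2^-1 * (J j l m x a + J j l x m a - J j m x l a
    + J l m x j a - D j l m x a)); last first.
  by rewrite -mulr_sumr sumrB big_split /= sumrB big_split /= !jac dh0 !subr0 !addr0 mulr0.
apply: eq_bigr => a _; rewrite /J /D.
rewrite /P /Q /E /G !(srt j l m x a).
by field.
Qed.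

(** The form in which cancellation by symmetry is used: [s] will be a transposition of summation
    indices under which the summand changes sign. *)
Lemma sum_skew0 (I : finType) (s : I -> I) (F : I -> R) :
  involutive s -> (forall p, F (s p) = - F p) -> \sum_p F p = 0.
Proof.
move=> sK Fs; have: \sum_p F p + \sum_p F p = 0.
  rewrite {1}(reindex_inj (inv_inj sK)) -big_split /= big1 // => p _.
  by rewrite Fs addNr.
by rewrite -mulr2n => /eqP; rewrite mulrn_eq0 => /eqP.
Qed.

(** Over quadruples, a permutation of the four indices is a single reindexing along a bijection. *)
Lemma sum4E (F : 'I_n -> 'I_n -> 'I_n -> 'I_n -> R) :
  \sum_k \sum_j \sum_l \sum_m F k j l m =
  \sum_(p : 'I_n * 'I_n * ('I_n * 'I_n)) F p.1.1 p.1.2 p.2.1 p.2.2.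
Proof.
rewrite pair_bigA /= [RHS](eq_bigr (fun p => F p.1.1 p.1.2 p.2.1 p.2.2)) //.
rewrite -(pair_bigA _ (fun q r => F q.1 q.2 r.1 r.2)) /=.
by apply: eq_bigr => q _; rewrite pair_bigA.
Qed.

(* Contract courant_jacobi22 with Q; every term not containing T cancels by symmetry,
   except the one with G, which is killed by courant_jacobi31 contracted with G. *)
Lemma ricci_bianchi x : \sum_i \sum_j T i j * P j i x = 0.
Proof.
pose Z k j l m := Q k j l * P l m k * P j m x.
have -> : \sum_i \sum_j T i j * P j i x =
    \sum_k \sum_j \sum_l \sum_m Z k j l m.
  rewrite exchange_big [RHS]exchange_big /=; apply: eq_bigr => j _.
  under [RHS]eq_bigr => k _ do rewrite exchange_big.
  rewrite [RHS]exchange_big; apply: eq_bigr => i _.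
  rewrite mulr_suml; apply: eq_bigr => k _.
  by rewrite mulr_suml; apply: eq_bigr => l _.
have skew0 (s : 'I_n * 'I_n * ('I_n * 'I_n) -> 'I_n * 'I_n * ('I_n * 'I_n)) F :
    involutive s ->
    (forall k j l m, F (s ((k, j), (l, m))) = - F ((k, j), (l, m)) :> R) ->
    \sum_p F p = 0.
  move=> sK Fs; apply: (sum_skew0 sK) => -[[k j] [l m]]; exact: Fs.
pose W1 k j l m := Q k j l * (- Q m l j * E m k x).
pose W2 k j l m := Q k j l * (G l j m * P m k x).
pose W3 k j l m := Q k j l * (Q k j m * Q x m l).
pose W4 k j l m := Q k j l * (Q k l m * Q x m j).
pose V k j l m := Q k j l * (P j k m * P l m x).
have sum0 : \sum_k \sum_j \sum_l \sum_m
    (W1 k j l m + W2 k j l m - V k j l m - Z k j l m + W3 k j l m - W4 k j l m)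
    = 0.
  rewrite big1 // => k _; rewrite big1 // => j _; rewrite big1 // => l _.
  transitivity (Q k j l * 0); last by rewrite mulr0.
  rewrite -[in RHS](courant_jacobi22 l j k x) mulr_sumr. apply: eq_bigr => m _.
  by rewrite /W1 /W2 /V /Z /W3 /W4 (conn_plusC l m k); ring.
pose S F := \sum_(p : 'I_n * 'I_n * ('I_n * 'I_n)) (F p.1.1 p.1.2 p.2.1 p.2.2 : R).
have W1_0 : S W1 = 0.
  apply: (skew0 (fun p => (p.2.2, p.1.2, (p.2.1, p.1.1)))).
    by move=> [[k j] [l m]].
  by move=> k j l m /=; rewrite /W1 (conn_minusC k j l) (conn_minusC m j l) (skew_plusC k m); ring.
have W3_0 : S W3 = 0.
  apply: (skew0 (fun p => (p.1, (p.2.2, p.2.1)))) => [[[k j] [l m]] //|].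
  by move=> k j l m /=; rewrite /W3 (conn_minusC x l m); ring.
have W4_0 : S W4 = 0.
  apply: (skew0 (fun p => (p.1.1, p.2.2, (p.2.1, p.1.2)))).
    by move=> [[k j] [l m]].
  move=> k j l m /=; rewrite /W4.
  by rewrite (conn_minusC x m j) (conn_minusC k l m) (conn_minusC k j l); ring.
have VZ : S V = S Z.
  rewrite /S (reindex_inj (inv_inj (_ : involutive
    (fun p : 'I_n * 'I_n * ('I_n * 'I_n) => (p.1.1, p.2.1, (p.1.2, p.2.2)))))) /=.
    apply: eq_bigr => -[[k j] [l m]] _ /=.
    by rewrite /V /Z (conn_minusC k j l) (conn_plusC l m k); ring.
  by move=> [[k j] [l m]].
have W2_0 : S W2 = 0.
  (* These are the six terms of [courant_jacobi31] multiplied by [G j l m]. Cyclic invariance of [G]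
     gives the three [U] terms the same sum, each [Y] term is odd under a transposition, and so 3
     times the sum of [U1] vanishes; the sum of [W2] is minus that of [U1]. *)
  pose U1 k j l m := G j l m * (Q k j l * P m k x).
  pose U2 k j l m := G j l m * (Q k l m * P j k x).
  pose U3 k j l m := G j l m * (Q k m j * P l k x).
  pose Y1 k j l m := G j l m * (G j l k * Q x k m).
  pose Y2 k j l m := G j l m * (G l m k * Q x k j).
  pose Y3 k j l m := G j l m * (G m j k * Q x k l).
  have sumU0 : \sum_j \sum_l \sum_m \sum_k
      (U1 k j l m + U2 k j l m + U3 k j l m
        - Y1 k j l m - Y2 k j l m - Y3 k j l m) = 0.
    rewrite big1 // => j _; rewrite big1 // => l _; rewrite big1 // => m _.
    transitivity (G j l m * 0); last by rewrite mulr0.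
    rewrite -[in RHS](courant_jacobi31 j l m x) mulr_sumr; apply: eq_bigr => k _.
    by rewrite /U1 /U2 /U3 /Y1 /Y2 /Y3; ring.
  pose S' F := \sum_(p : 'I_n * 'I_n * ('I_n * 'I_n))
    (F p.2.2 p.1.1 p.1.2 p.2.1 : R).
  have Y1_0 : S' Y1 = 0.
    apply: (skew0 (fun p => (p.1, (p.2.2, p.2.1)))) => [[[j l] [m k]] //|].
    by move=> j l m k /=; rewrite /Y1 (conn_minusC x k m); ring.
  have Y2_0 : S' Y2 = 0.
    apply: (skew0 (fun p => (p.2.2, p.1.2, (p.2.1, p.1.1)))).
      by move=> [[j l] [m k]].
    by move=> j l m k /=; rewrite /Y2 (conn_minusC x k j) !(skew_minus_rot _ l m); ring.
  have Y3_0 : S' Y3 = 0.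
    apply: (skew0 (fun p => (p.1.1, p.2.2, (p.2.1, p.1.2)))).
      by move=> [[j l] [m k]].
    by move=> j l m k /=; rewrite /Y3 (conn_minusC x k l) -!(skew_minus_rot m j); ring.
  have U21 : S' U2 = S' U1.
    rewrite /S' (reindex_inj (can_inj (_ : cancel
      (fun p : 'I_n * 'I_n * ('I_n * 'I_n) => (p.2.1, p.1.1, (p.1.2, p.2.2)))
      (fun p => (p.1.2, p.2.1, (p.1.1, p.2.2)))))) /=.
      by apply: eq_bigr => -[[j l] [m k]] _ /=; rewrite /U1 /U2 -(skew_minus_rot m j l).
    by move=> [[j l] [m k]].
  have U32 : S' U3 = S' U2.
    rewrite /S' (reindex_inj (can_inj (_ : cancel
      (fun p : 'I_n * 'I_n * ('I_n * 'I_n) => (p.2.1, p.1.1, (p.1.2, p.2.2)))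
      (fun p => (p.1.2, p.2.1, (p.1.1, p.2.2)))))) /=.
      by apply: eq_bigr => -[[j l] [m k]] _ /=; rewrite /U3 /U2 -(skew_minus_rot m j l).
    by move=> [[j l] [m k]].
  have W2U : S W2 = - S' U1.
    rewrite /S /S' (reindex_inj (can_inj (_ : cancel
      (fun p : 'I_n * 'I_n * ('I_n * 'I_n) => (p.2.2, p.1.1, (p.1.2, p.2.1)))
      (fun p => (p.1.2, p.2.1, (p.2.2, p.1.1)))))) /=.
      rewrite -sumrN; apply: eq_bigr => -[[j l] [m k]] _ /=.
      by rewrite /U1 /W2 (skew_minusC j l); ring.
    by move=> [[j l] [m k]].
  have : S' U1 + S' U2 + S' U3 - S' Y1 - S' Y2 - S' Y3 = 0.
    rewrite -[RHS]sumU0 (sum4E (fun j l m k => U1 k j l m + U2 k j l m + U3 k j l m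
        - Y1 k j l m - Y2 k j l m - Y3 k j l m)) /S'.
    by rewrite 3!sumrB 2!big_split.
  rewrite Y1_0 Y2_0 Y3_0 !subr0 U32 U21 W2U => /eqP.
  rewrite -mulr2n -mulrSr mulrn_eq0 => /eqP ->.
  by rewrite oppr0.
(* [V] and [Z] have equal sums and enter with the same sign, so twice the wanted sum is zero. *)
have : S W1 + S W2 - S V - S Z + S W3 - S W4 = 0.
  rewrite -[RHS]sum0 (sum4E (fun k j l m => W1 k j l m + W2 k j l m
    - V k j l m - Z k j l m + W3 k j l m - W4 k j l m)) /S.
  by rewrite sumrB big_split /= 2!sumrB big_split.
rewrite W1_0 W2_0 W3_0 W4_0 VZ !addr0 subr0 sub0r -opprD -mulr2n => /eqP.
by rewrite sum4E oppr_eq0 mulrn_eq0 => /eqP.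
Qed.

(** For fixed k the numbers [P j i k] form an array in (i, j). [ricci_bianchi] makes T orthogonal to
    each of these arrays, while the hypothesis places T in their span. *)
Lemma ricci_eq0 p :
  (forall i j, T i j = \sum_k P j i k * p k) -> forall i j, T i j = 0.
Proof.
move=> Tp; have: \sum_i \sum_j T i j ^+ 2 = 0.
  transitivity (\sum_k (\sum_i \sum_j T i j * P j i k) * p k); last first.
    by rewrite big1 // => k _; rewrite ricci_bianchi mul0r.
  under [RHS]eq_bigr => k _ do rewrite mulr_suml.
  rewrite [RHS]exchange_big; apply: eq_bigr => i _.
  under [RHS]eq_bigr => k _ do rewrite mulr_suml.
  rewrite [RHS]exchange_big; apply: eq_bigr => j _.
  rewrite expr2 {2}Tp mulr_sumr; apply: eq_bigr => k _; exact: mulrA.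
move=> T2 i j; apply/eqP; rewrite -sqrf_eq0; apply/eqP; move: j.
have T2i : \sum_j T i j ^+ 2 = 0.
  move: i (erefl true); apply: psumr_eq0P => // i _.
  by apply: sumr_ge0 => j _; apply: sqr_ge0.
by move=> j; apply: (psumr_eq0P _ T2i) => // k _; apply: sqr_ge0.
Qed.

(* For x orthogonal to the derived algebra, 4 T(x, x) is the sum of the squares of the
   entries of S + H, with S (twice the symmetric part of ad x) symmetric and H (the
   contraction of h with x) skew. *)
Lemma ricci_perp x :
  (forall i j, T i j = 0) -> (forall i j, \sum_k c i j k * x k = 0) ->
  forall k l, \sum_i x i * (c i k l + c i l k) = 0 /\ \sum_i x i * h k i l = 0.
Proof.
move=> T0 cx; pose S k l := \sum_i x i * (c i k l + c i l k).
pose H k l := \sum_i x i * h k i l.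
have SC k l : S l k = S k l by apply: eq_bigr => i _; rewrite addrC.
have HC k l : H l k = - H k l.
  by rewrite /H -sumrN; apply: eq_bigr => i _; rewrite hC12 hC23 hC12; ring.
(* Contracted with [x], [Q] and [P] give one and the same matrix, which is why T(x, x) is a sum of
   squares. The term left over pairs [x] with a bracket and vanishes by [cx]. *)
have Qx k l : \sum_j x j * Q k j l = - ((S k l + H k l) / 2).
  transitivity (\sum_j (- ((x j * (c j k l + c j l k) + x j * h k j l) / 2)
      + (c l k j * x j) / 2)).
    by apply: eq_bigr => j _; rewrite /Q (cC j k); field.
  by rewrite big_split /= sumrN -!mulr_suml big_split /= cx mul0r addr0.
have Px k l : \sum_i x i * P l i k = - ((S k l + H k l) / 2).
  transitivity (\sum_i (- ((x i * (c i k l + c i l k) + x i * h k i l) / 2)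
      + (c k l i * x i) / 2)).
    apply: eq_bigr => i _; rewrite /P (cC i l) hC12 (hC23 i k) (hC12 k i).
    by field.
  by rewrite big_split /= sumrN -!mulr_suml big_split /= cx mul0r addr0.
have sq0 : \sum_k \sum_l (S k l + H k l) ^+ 2 = 0.
  transitivity (2 ^+ 2 * \sum_i \sum_j x i * x j * T i j); last first.
    by rewrite big1 ?mulr0 // => i _; rewrite big1 // => j _; rewrite T0 mulr0.
  transitivity (2 ^+ 2 * \sum_k \sum_l
    ((\sum_j x j * Q k j l) * (\sum_i x i * P l i k))).
    rewrite mulr_sumr; apply: eq_bigr => k _; rewrite mulr_sumr.
    by apply: eq_bigr => l _; rewrite Qx Px; field.
  congr (_ * _); pose F k l j i := x i * x j * (Q k j l * P l i k).
  transitivity (\sum_k \sum_l \sum_j \sum_i F k l j i).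
    apply: eq_bigr => k _; apply: eq_bigr => l _; rewrite big_distrlr /=.
    by apply: eq_bigr => j _; apply: eq_bigr => i _; rewrite /F; ring.
  transitivity (\sum_i \sum_j \sum_k \sum_l F k l j i); last first.
    apply: eq_bigr => i _; apply: eq_bigr => j _; rewrite mulr_sumr.
    by apply: eq_bigr => k _; rewrite mulr_sumr.
  rewrite sum4E (sum4E (fun i j k l => F k l j i)).
  rewrite (reindex_inj (can_inj (_ : cancel
    (fun p : 'I_n * 'I_n * ('I_n * 'I_n) => (p.2.1, p.2.2, (p.1.2, p.1.1)))
    (fun p => (p.2.2, p.2.1, (p.1.1, p.1.2)))))) /=; first by [].
  by move=> [[i j] [k l]].
have SH0 k l : S k l + H k l = 0.
  apply/eqP; rewrite -sqrf_eq0; apply/eqP; move: l.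
  have sqk : \sum_l (S k l + H k l) ^+ 2 = 0.
    move: k (erefl true); apply: psumr_eq0P => // k _.
    by apply: sumr_ge0 => l _; apply: sqr_ge0.
  by move=> l; apply: (psumr_eq0P _ sqk) => // m _; apply: sqr_ge0.
move=> k l; have := SH0 k l; have := SH0 l k; rewrite SC HC => e1 e2.
have S2 : S k l *+ 2 = 0 by rewrite mulr2n -[RHS]e1 -[X in X - _]addr0 -{}e2; ring.
have S0 : S k l = 0 by apply/eqP; move/eqP: S2; rewrite mulrn_eq0.
by split=> //; move: e2; rewrite S0 add0r.
Qed.

(** The vector [t] represents the functional X -> tr(ad X). It is orthogonal to all brackets because
    tr(ad [X, Y]) = 0, a contraction of the Jacobi identity. By [ricci_perp] ad t is then skew, so
    its trace, which is the squared norm of [t], is zero. *)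
Lemma trace_eq0 : (forall i j, T i j = 0) -> forall k, \sum_i c k i i = 0.
Proof.
move=> T0; pose t k := \sum_i c k i i.
have tperp i j : \sum_k c i j k * t k = 0.
  have: \sum_k \sum_m J i j k k m = 0 by rewrite big1.
  rewrite exchange_big /= /J.
  under eq_bigr => m _ do rewrite !big_split /= -mulr_sumr.
  rewrite !big_split /= -addrA => tJ; rewrite -[LHS]addr0 -[RHS]tJ.
  congr (_ + _); apply/esym.
  rewrite [X in _ + X]exchange_big /= -big_split big1 // => m _.
  by rewrite -big_split big1 // => k _ /=; rewrite (cC k j); ring.
have /(_ _ _)/proj1 tS := ricci_perp T0 tperp.
have t2 : \sum_k t k ^+ 2 = 0.
  have: \sum_k \sum_i t i * (c i k k + c i k k) = 0 by rewrite big1.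
  rewrite exchange_big /=.
  under eq_bigr => i _ do rewrite -mulr_sumr big_split /= -/(t i) -mulr2n.
  rewrite (eq_bigr (fun i => t i ^+ 2 *+ 2)); last first.
    by move=> i _; rewrite expr2 mulrnAr.
  by rewrite sumrMnl => /eqP; rewrite mulrn_eq0 => /eqP.
move=> k; apply/eqP; rewrite -[_ == _](sqrf_eq0 (t k)); apply/eqP.
by apply: (psumr_eq0P _ t2) => // i _; apply: sqr_ge0.
Qed.
End Arrays.

(** * Structure constants in dimension four *)

Lemma sum_ord4 (V : nmodType) (F : 'I_4 -> V) :
  \sum_i F i = F 0 + F 1 + F 2 + F 3.
Proof.
rewrite !big_ord_recl big_ord0 addr0 !addrA.
by congr (F _ + F _ + F _ + F _); apply: val_inj.
Qed.

Lemma forall_ord4 (P : 'I_4 -> Prop) : P 0 -> P 1 -> P 2 -> P 3 -> forall i, P i.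
Proof.
move=> P0 P1 P2 P3 [[|[|[|[|//]]]] i4].
- by rewrite (_ : Ordinal _ = 0) //; apply: val_inj.
- by rewrite (_ : Ordinal _ = 1) //; apply: val_inj.
- by rewrite (_ : Ordinal _ = 2) //; apply: val_inj.
- by rewrite (_ : Ordinal _ = 3) //; apply: val_inj.
Qed.

Lemma skew_ord4 (V : zmodType) (F : 'I_4 -> 'I_4 -> V) :
  (forall i j, F j i = - F i j) -> (forall i, F i i = 0) ->
  F 0 1 = 0 -> F 0 2 = 0 -> F 0 3 = 0 -> F 1 2 = 0 -> F 1 3 = 0 -> F 2 3 = 0 ->
  forall i j, F i j = 0.
Proof.
move=> FC Fii F01 F02 F03 F12 F13 F23.
by do 2![apply: forall_ord4]; rewrite ?Fii // FC ?(F01, F02, F03, F12, F13, F23) oppr0.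
Qed.

(** * Symmetric three by three matrices with a given adjugate *)

Section SymmetricAdjugate.
Variables (R : realFieldType) (n00 n11 n22 n01 n02 n12 s : R).
Hypotheses (e00 : n11 * n22 - n12 ^+ 2 = s) (e11 : n00 * n22 - n02 ^+ 2 = s).
Hypotheses (e22 : n00 * n11 - n01 ^+ 2 = s) (e01 : n01 * n22 - n02 * n12 = 0).
Hypotheses (e02 : n01 * n12 - n02 * n11 = 0) (e12 : n00 * n12 - n01 * n02 = 0).

(** The hypotheses say that N has adjugate s times the identity, so N adj(N) = det(N) reads s N =
    det(N), and N is scalar. Each entry below is obtained by writing its product with [s] as a
    combination of the vanishing minors. *)
Lemma scalar_of_adjugate : s != 0 ->
  [/\ n01 = 0, n02 = 0 & n12 = 0] /\ [/\ n11 = n00, n22 = n00 & n00 ^+ 2 = s].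
Proof.
move=> s0; have sI x : x * s = 0 -> x = 0.
  by move/eqP; rewrite mulf_eq0 (negPf s0) orbF => /eqP.
have f01 : n01 = 0.
  apply: sI; transitivity (n00 * (n01 * n22 - n02 * n12)
    + n02 * (n00 * n12 - n01 * n02)); last by rewrite e01 e12 !mulr0 addr0.
  by rewrite -e11; ring.
have f02 : n02 = 0.
  apply: sI; transitivity (- n00 * (n01 * n12 - n02 * n11)
    + n01 * (n00 * n12 - n01 * n02)); last by rewrite e02 e12 !mulr0 addr0.
  by rewrite -e22; ring.
have f12 : n12 = 0.
  apply: sI; transitivity (- n01 * (n01 * n12 - n02 * n11)
    + n11 * (n00 * n12 - n01 * n02)); last by rewrite e02 e12 !mulr0 addr0.
  by rewrite -e22; ring.
have f11 : n11 = n00.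
  apply/eqP; rewrite -subr_eq0; apply/eqP/sI.
  by rewrite mulrBl -{1}e11 -e00 f12 f02; ring.
have f22 : n22 = n00.
  apply/eqP; rewrite -subr_eq0; apply/eqP/sI.
  by rewrite mulrBl -{1}e22 -e00 f12 f01; ring.
by split; split=> //; rewrite -e22 f11 f01; ring.
Qed.
End SymmetricAdjugate.

(* With N = tr L - 2 L, the vanishing of the adjugate of N gives N^2 = (tr N) N, so
   the columns of N are in the kernel of L. *)
Lemma kernel_of_adjugate (R : realFieldType) (l00 l11 l22 l01 l02 l12 : R)
    (n00 := l11 + l22 - l00) (n11 := l00 + l22 - l11) (n22 := l00 + l11 - l22)
    (n01 := - 2 * l01) (n02 := - 2 * l02) (n12 := - 2 * l12) :
  n11 * n22 - n12 ^+ 2 = 0 -> n00 * n22 - n02 ^+ 2 = 0 ->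
  n00 * n11 - n01 ^+ 2 = 0 -> n01 * n22 = n02 * n12 ->
  n01 * n12 = n02 * n11 -> n00 * n12 = n01 * n02 ->
  exists m0 m1 m2, [|| m0 != 0, m1 != 0 | m2 != 0] /\
    [/\ l00 * m0 + l01 * m1 + l02 * m2 = 0, l01 * m0 + l11 * m1 + l12 * m2 = 0 &
        l02 * m0 + l12 * m1 + l22 * m2 = 0].
Proof.
rewrite /n00 /n11 /n22 /n01 /n02 /n12 => e00 e11 e22 e01 e02 e12.
have [nz|nz] := boolP [|| n00 != 0, n01 != 0 | n02 != 0].
  exists n00, n01, n02; split=> //.
  by rewrite /n00 /n01 /n02; clear - e00 e11 e22 e01 e02 e12; split; lra.
have [nz1|nz1] := boolP [|| n01 != 0, n11 != 0 | n12 != 0].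
  exists n01, n11, n12; split=> //.
  by rewrite /n11 /n01 /n12; clear - e00 e11 e22 e01 e02 e12; split; lra.
have [nz2|nz2] := boolP [|| n02 != 0, n12 != 0 | n22 != 0].
  exists n02, n12, n22; split=> //.
  by rewrite /n02 /n12 /n22; clear - e00 e11 e22 e01 e02 e12; split; lra.
move: nz nz1 nz2; rewrite !negb_or !negbK => /and3P[/eqP z0 /eqP z1 /eqP z2].
move=> /and3P[_ /eqP z3 /eqP z4] /and3P[_ _ /eqP z5].
(* Here N = 0. Since tr N = tr L, also L = (tr N - N) / 2 = 0, and any nonzero vector is in the
   kernel. *)
exists 1, 0, 0; rewrite oner_eq0; split=> //.
move: z0 z1 z2 z3 z4 z5; rewrite /n00 /n01 /n02 /n11 /n12 /n22.
by clear; split; lra.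
Qed.

Section Four.
Variables (R : realFieldType) (c h : 'I_4 -> 'I_4 -> 'I_4 -> R).
Local Notation P := (conn_plus c h).
Local Notation Q := (conn_minus c h).
Local Notation T := (ricci c h).
Local Notation J := (jacobi_term c).
Hypothesis cC : forall i j k, c j i k = - c i j k.
Hypothesis hC12 : forall i j k, h j i k = - h i j k.
Hypothesis hC23 : forall i j k, h i k j = - h i j k.
Hypothesis jac : forall i j k l, \sum_m J i j k l m = 0.
Hypothesis tr0 : forall k, \sum_i c k i i = 0.

Lemma bracket_eq0 i k : c i i k = 0.
Proof. by apply/eqP; rewrite -[_ == _](mulrn_eq0 _ 2) mulr2n {1}cC addNr. Qed.

(* If b_1 = 0, then V = d(g^* ) would be a 4-dimensional subspace of the space of
   2-forms, isotropic for the wedge product (signature (3, 3)) because 3-forms on a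
   unimodular 4-dimensional Lie algebra are closed. So some nonzero x has a
   self-dual, hence vanishing, dx. *)
Lemma perp_exists :
  exists2 x : 'I_4 -> R, exists i, x i != 0 & forall i j, \sum_k c i j k * x k = 0.
Proof.
pose A : 'M[R]_4 := \matrix_(k, j) nth 0 [:: c 0 1 k - c 2 3 k;
  c 0 2 k + c 1 3 k; c 0 3 k - c 1 2 k] j.
have /det0P[v v0 vA] : \det A == 0.
  apply/eqP; rewrite (expand_det_col A 3) big1 // => i _.
  by rewrite mxE /= mul0r.
pose x k := v 0 k; pose w i j := \sum_k c i j k * x k.
have wE i j : w i j = c i j 0 * x 0 + c i j 1 * x 1 + c i j 2 * x 2 + c i j 3 * x 3.
  exact: sum_ord4.
have vAj j : \sum_k x k * A k j = 0 by have /matrixP/(_ 0 j) := vA; rewrite !mxE.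
have e1 : w 0 1 = w 2 3.
  have := vAj 0; rewrite sum_ord4 !mxE /= !wE => e; lra.
have e2 : w 0 2 = - w 1 3.
  have := vAj 1; rewrite sum_ord4 !mxE /= !wE => e; lra.
have e3 : w 0 3 = w 1 2.
  have := vAj 2; rewrite sum_ord4 !mxE /= !wE => e; lra.
pose jc i j k := \sum_m (c i j m * w m k + c j k m * w m i + c k i m * w m j).
have JJ i k l : jc i k l = 0.
  rewrite /jc.
  transitivity (\sum_p (\sum_m J i k l p m) * x p); last first.
    by rewrite big1 // => p _; rewrite jac mul0r.
  under [RHS]eq_bigr => p _ do rewrite mulr_suml.
  rewrite exchange_big; apply: eq_bigr => m _ /=.
  rewrite !mulr_sumr -!big_split /=; apply: eq_bigr => p _.
  by rewrite /jacobi_term; ring.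
have w2 : w 0 1 ^+ 2 + w 0 2 ^+ 2 + w 0 3 ^+ 2 = 0.
  transitivity (w 0 1 * w 2 3 - w 0 2 * w 1 3 + w 0 3 * w 1 2).
    by rewrite -e1 -e3 -[w 1 3]opprK -e2; ring.
  pose t k := \sum_i c k i i; have t0 k : t k = 0 by apply: tr0.
  pose eta i j k := x i * w j k + x j * w k i + x k * w i j.
  (* Up to signs this is the Leibniz rule for d(x ^ w), evaluated on the basis: [jc] is dw, and the
     differential of the three-form [eta] = x ^ w involves only the traces [t]. The factor 1/2 is
     due to w ^ w containing each product twice. *)
  transitivity (2^-1 * (x 0 * jc 1 2 3 - x 1 * jc 0 2 3 + x 2 * jc 0 1 3
    - x 3 * jc 0 1 2 + t 0 * eta 1 2 3 - t 1 * eta 0 2 3 + t 2 * eta 0 1 3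
    - t 3 * eta 0 1 2)); last by rewrite !JJ !t0; ring.
  rewrite /jc /t /eta !sum_ord4 !wE !bracket_eq0.
  rewrite !(cC 0 1, cC 0 2, cC 0 3, cC 1 2, cC 1 3, cC 2 3).
  by field.
have sq0 a b d : a ^+ 2 + b ^+ 2 + d ^+ 2 = 0 :> R -> a = 0.
  move=> e; apply/eqP; rewrite -sqrf_eq0 eq_le sqr_ge0 andbT -e -addrA.
  by rewrite lerDl addr_ge0 ?sqr_ge0.
have w01 := sq0 _ _ _ w2.
have w02 : w 0 2 = 0 by apply: (sq0 _ (w 0 1) (w 0 3)); rewrite -w2; ring.
have w03 : w 0 3 = 0 by apply: (sq0 _ (w 0 1) (w 0 2)); rewrite -w2; ring.
exists x.
  apply/existsP; apply: contraNT v0; rewrite negb_exists => /forallP v0.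
  apply/eqP/matrixP => i j; rewrite (ord1 i) mxE; apply/eqP.
  by move: (v0 j); rewrite negbK.
have wC i j : w j i = - w i j.
  by rewrite /w -sumrN; apply: eq_bigr => k _; rewrite cC mulNr.
have w12 : w 1 2 = 0 by rewrite -e3.
have w23 : w 2 3 = 0 by rewrite -e1.
have w13 : w 1 3 = 0 by rewrite -[w 1 3]opprK -e2 w02 oppr0.
apply: skew_ord4; rewrite -/(w _ _) // => i.
by rewrite /w big1 // => k _; rewrite bracket_eq0 mul0r.
Qed.

Hypothesis T0 : forall i j, T i j = 0.

Lemma skew12_eq0 i k : h i i k = 0.
Proof. by apply/eqP; rewrite -[_ == _](mulrn_eq0 _ 2) mulr2n {1}hC12 addNr. Qed.
Lemma skew23_eq0 i k : h i k k = 0.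
Proof. by apply/eqP; rewrite -[_ == _](mulrn_eq0 _ 2) mulr2n {1}hC23 addNr. Qed.
Lemma skew13_eq0 i k : h i k i = 0.
Proof. by rewrite hC23 skew12_eq0 oppr0. Qed.

Lemma perp_basis a : (forall i j, c i j a = 0) ->
  (forall k l, c a l k = - c a k l) /\ (forall k l, h k a l = 0).
Proof.
move=> ca; have cx i j : \sum_k c i j k * (k == a)%:R = 0.
  by rewrite (bigD1 a) //= ca mul0r add0r big1 // => k /negPf ->; rewrite mulr0.
have sumx (F : 'I_4 -> R) : \sum_i (i == a)%:R * F i = F a.
  rewrite (bigD1 a) //= eqxx mul1r big1 ?addr0 // => k /negPf ->.
  by rewrite mul0r.
have := ricci_perp cC hC12 hC23 T0 cx; split=> k l; have := H k l.
  by rewrite !sumx => -[/eqP + _]; rewrite addrC addr_eq0 => /eqP.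
by rewrite !sumx => -[].
Qed.

(** * The ideal orthogonal to the last basis vector *)

Section Perp3.
Hypothesis c3 : forall i j, c i j 3 = 0.

(** Stated as a product of equations so that its proof is one multi-rule for [rewrite]. The first
    three equations come from unimodularity and make L symmetric. The constants that remain are the
    six entries of L, the three entries of the skew map ad of the last basis vector, and
    [h 0 1 2]. *)
Lemma perp3_nf :
  (((c 2 0 0 = c 1 2 1) * (c 0 1 0 = c 1 2 2) * (c 0 1 1 = c 2 0 2)) *
  ((forall k, c 1 0 k = - c 0 1 k) * (forall k, c 2 1 k = - c 1 2 k) *
   (forall k, c 0 2 k = - c 2 0 k) * (forall i j, c i j 3 = 0)) *
  ((forall k, c 0 3 k = - c 3 0 k) * (forall k, c 1 3 k = - c 3 1 k) *
   (forall k, c 2 3 k = - c 3 2 k)) *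
  ((forall k, c 3 k k = 0) * (c 3 1 0 = - c 3 0 1) * (c 3 0 2 = - c 3 2 0) *
   (c 3 2 1 = - c 3 1 2)) * (forall i k, c i i k = 0) *
  ((forall i k, h i i k = 0) * (forall i k, h i k k = 0) *
    (forall i k, h i k i = 0)) *
  ((forall i k, h 3 i k = 0) * (forall i k, h i 3 k = 0) *
   (forall i k, h i k 3 = 0)) *
  ((h 1 2 0 = h 0 1 2) * (h 2 0 1 = h 0 1 2) * (h 1 0 2 = - h 0 1 2) *
   (h 0 2 1 = - h 0 1 2) * (h 2 1 0 = - h 0 1 2)))%type.
Proof.
have [s3 h3] := perp_basis c3.
have t k := tr0 k; have := t 0; have := t 1; have := t 2; rewrite !sum_ord4.
rewrite !c3 !bracket_eq0 !addr0 !add0r => t2 t1 t0.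
have e2 : c 2 0 0 = c 1 2 1 by rewrite (cC 1 2) in t2; lra.
have e1 : c 0 1 0 = c 1 2 2 by rewrite (cC 0 1) in t1; lra.
have e0 : c 0 1 1 = c 2 0 2 by rewrite (cC 2 0) in t0; lra.
have h3' i k : h 3 i k = 0 by rewrite hC12 h3 oppr0.
have h3'' i k : h i k 3 = 0 by rewrite hC23 h3 oppr0.
have skk k : c 3 k k = 0.
  by apply/eqP; rewrite -[_ == _](mulrn_eq0 _ 2) mulr2n {1}s3 addNr.
have h120 : h 1 2 0 = h 0 1 2 by rewrite hC23 hC12 opprK.
have h201 : h 2 0 1 = h 0 1 2 by rewrite hC12 hC23 opprK.
have h210 : h 2 1 0 = - h 0 1 2 by rewrite hC12 h120.
do !split=> //; by [exact: bracket_eq0 | exact: skew12_eq0 | exact: skew23_eq0 | exact: skew13_eq0].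
Qed.

Local Notation n00 := (c 2 0 1 + c 0 1 2 - c 1 2 0).
Local Notation n11 := (c 1 2 0 + c 0 1 2 - c 2 0 1).
Local Notation n22 := (c 1 2 0 + c 2 0 1 - c 0 1 2).
Local Notation n01 := (- 2 * c 1 2 1).
Local Notation n02 := (- 2 * c 1 2 2).
Local Notation n12 := (- 2 * c 2 0 2).

(* Up to the factor -1/2, [T] on the ideal spanned by the first three basis vectors is
   the adjugate of tr L - 2 L minus_lift the identity times the square of [h 0 1 2],
   where the bracket of e_i and e_j is L (e_i x e_j). *)
Lemma perp3_ricci :
  [/\ n11 * n22 - n12 ^+ 2 = h 0 1 2 ^+ 2,
      n00 * n22 - n02 ^+ 2 = h 0 1 2 ^+ 2 &
      n00 * n11 - n01 ^+ 2 = h 0 1 2 ^+ 2] /\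
  [/\ n01 * n22 = n02 * n12, n01 * n12 = n02 * n11 & n00 * n12 = n01 * n02].
Proof.
have nf := perp3_nf.
have e00 : T 0 0 = - (n11 * n22 - n12 ^+ 2 - h 0 1 2 ^+ 2) / 2.
  by rewrite /ricci !sum_ord4 /conn_plus /conn_minus !nf; field.
have e11 : T 1 1 = - (n00 * n22 - n02 ^+ 2 - h 0 1 2 ^+ 2) / 2.
  by rewrite /ricci !sum_ord4 /conn_plus /conn_minus !nf; field.
have e22 : T 2 2 = - (n00 * n11 - n01 ^+ 2 - h 0 1 2 ^+ 2) / 2.
  by rewrite /ricci !sum_ord4 /conn_plus /conn_minus !nf; field.
have e01 : T 0 1 = (n01 * n22 - n02 * n12) / 2.
  by rewrite /ricci !sum_ord4 /conn_plus /conn_minus !nf; field.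
have e02 : T 0 2 = - (n01 * n12 - n02 * n11) / 2.
  by rewrite /ricci !sum_ord4 /conn_plus /conn_minus !nf; field.
have e12 : T 1 2 = (n00 * n12 - n01 * n02) / 2.
  by rewrite /ricci !sum_ord4 /conn_plus /conn_minus !nf; field.
rewrite !T0 in e00 e11 e22 e01 e02 e12.
by split; split; lra.
Qed.

Lemma perp3_so3 : h 0 1 2 != 0 ->
  [/\ c 2 0 1 = c 0 1 2, c 1 2 0 = c 0 1 2 & c 0 1 2 ^+ 2 = h 0 1 2 ^+ 2] /\
  [/\ c 1 2 1 = 0, c 1 2 2 = 0 & c 2 0 2 = 0].
Proof.
move=> h0; have [[e00 e11 e22] [e01 e02 e12]] := perp3_ricci.
have h20 : h 0 1 2 ^+ 2 != 0 by rewrite sqrf_eq0.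
move/eqP: e01; rewrite -subr_eq0 => /eqP e01.
move/eqP: e02; rewrite -subr_eq0 => /eqP e02.
move/eqP: e12; rewrite -subr_eq0 => /eqP e12.
have [[f1 f2 f3] [g1 g2 g3]] := scalar_of_adjugate e00 e11 e22 e01 e02 e12 h20.
split; split; try lra.
(* For scalar L the trace is three times the eigenvalue, so N = 3 L - 2 L = L. *)
by rewrite -g3; congr (_ ^+ 2); lra.
Qed.

(** The map ad of the last basis vector is a rotation of the plane of indices 1, 2 with speed
    [c 3 1 2]. If the speed is zero, brackets lie in the image of L, whose orthogonal is the kernel
    of L by symmetry. Otherwise L commutes with the rotation, and the vector of index 0 itself is
    orthogonal to all brackets. *)
Lemma perp3_kernel : h 0 1 2 = 0 -> (forall k, c 3 0 k = 0) ->
  exists y : 'I_4 -> R,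
    [/\ exists i, y i != 0, y 3 = 0 & forall i j, \sum_k c i j k * y k = 0].
Proof.
move=> h0 c30; have nf := perp3_nf.
have [[e00 e11 e22] [e01 e02 e12]] := perp3_ricci.
rewrite h0 expr0n /= in e00 e11 e22.
have c32 : c 3 2 0 = 0 by have := c30 2; rewrite nf => e; lra.
have suff_y (y : 'I_4 -> R) : y 3 = 0 ->
    c 3 1 2 * y 2 = 0 -> c 3 1 2 * y 1 = 0 ->
    c 1 2 0 * y 0 + c 1 2 1 * y 1 + c 1 2 2 * y 2 = 0 ->
    c 1 2 1 * y 0 + c 2 0 1 * y 1 + c 2 0 2 * y 2 = 0 ->
    c 1 2 2 * y 0 + c 2 0 2 * y 1 + c 0 1 2 * y 2 = 0 ->
    forall i j, \sum_k c i j k * y k = 0.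
  move=> y3 w2 w1 l0 l1 l2.
  have w1' : - c 3 1 2 * y 1 = 0 by rewrite mulNr w1 oppr0.
  apply: (skew_ord4 (F := fun i j => \sum_k c i j k * y k)) => [i j|i||||||].
  - by rewrite -sumrN; apply: eq_bigr => k _; rewrite cC mulNr.
  - by rewrite big1 // => k _; rewrite bracket_eq0 mul0r.
  1-6: by rewrite /= sum_ord4 !nf ?c30 ?c32; lra.
have [w0|w0] := eqVneq (c 3 1 2) 0; last first.
  exists (fun k => (k == 0)%:R); split=> //.
    by exists 0; rewrite oner_eq0.
  have wI z : c 3 1 2 * z = 0 -> z = 0.
    by move/eqP; rewrite mulf_eq0 (negPf w0) => /eqP.
  (* The Jacobi identity with index 3 says that the rotation is a derivation; it forces L = diag(l,
     m, m). One diagonal entry of the adjugate of N is then l^2, whence l = 0. *)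
  have j2 := jac 3 0 1 1; have j3 := jac 3 0 1 2.
  have j5 := jac 3 1 2 1; have j6 := jac 3 1 2 2.
  rewrite !sum_ord4 /jacobi_term !nf ?c30 ?c32 in j2 j3 j5 j6.
  have l11 : c 0 1 2 - c 2 0 1 = 0 by apply: wI; lra.
  have l12 : c 2 0 2 = 0 by apply: wI; lra.
  have l02 : c 1 2 2 = 0 by apply: wI; lra.
  have l01 : c 1 2 1 = 0 by apply: wI; lra.
  have l00 : c 1 2 0 = 0.
    apply/eqP; rewrite -sqrf_eq0 -[X in _ == X]e00 l12; apply/eqP.
    by rewrite (_ : c 0 1 2 = c 2 0 1); [ring | lra].
  by apply: suff_y; rewrite ?l12 ?l02 ?l01 ?l00 /=; ring.
have [m0 [m1 [m2 [mN0 [l0 l1 l2]]]]] :=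
  kernel_of_adjugate e00 e11 e22 e01 e02 e12.
exists (fun k => [:: m0; m1; m2; 0]`_k).
split; [|by []|by apply: suff_y; rewrite ?w0 ?mul0r].
by case/or3P: mN0 => mi; [exists 0 | exists 1 | exists 2].
Qed.
End Perp3.

(** A three-form killed by two basis vectors lives on a plane, hence is zero. The bracket of the two
    other vectors vanishes by unimodularity. The maps ad e_2 and ad e_3 are skew with image in that
    plane, so both are multiples of the same rotation. *)
Lemma perp23_flat : (forall i j, c i j 2 = 0) -> (forall i j, c i j 3 = 0) ->
  [/\ forall i j k, h i j k = 0, forall k, c 0 1 k = 0, forall k, c 2 3 k = 0,
      forall a k, a \in [:: 2; 3] -> c a 0 k = (k == 1)%:R * c a 0 1 &
      forall a k, a \in [:: 2; 3] -> c a 1 k = - (k == 0)%:R * c a 0 1].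
Proof.
move=> c2 c3; have [s2 h2] := perp_basis c2; have [s3 h3] := perp_basis c3.
have nf := perp3_nf c3.
have c01 : forall k, c 0 1 k = 0 by apply: forall_ord4; rewrite ?nf ?c2.
have h0 : h 0 1 2 = 0 by rewrite hC23 h2 oppr0.
have s0 (F : 'I_4 -> 'I_4 -> R) : (forall k l, F l k = - F k l) -> forall k, F k k = 0.
  by move=> FC k; apply/eqP; rewrite -[_ == _](mulrn_eq0 _ 2) mulr2n {1}FC addNr.
split=> //.
- by do 3![apply: forall_ord4]; rewrite ?nf ?h0 ?oppr0.
- by move=> k; rewrite cC s3 c2 !oppr0.
- move=> a k; rewrite !inE => /orP[]/eqP-> {a}; move: k; apply: forall_ord4;
  by rewrite ?c2 ?c3 ?(s0 _ s2) ?(s0 _ s3) ?mul0r ?mul1r.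
- move=> a k; rewrite !inE => /orP[]/eqP-> {a}; move: k; apply: forall_ord4;
  rewrite ?c2 ?c3 ?(s0 _ s2) ?(s0 _ s3) ?oppr0 ?mul0r ?mulN1r //=.
Qed.
End Four.

(** * The Ricci curvatures in an orthonormal basis *)

(** [linfun] accepts any function but agrees with it only if the function is linear. The notions are
    defined by [linfun] of bare functions, so their linearity is discharged through this lemma. *)
Lemma linfun_linearE (K : fieldType) (aT rT : vectType K) (f : aT -> rT) :
  linear f -> linfun f =1 f.
Proof.
move=> lf; pose F : {linear aT -> rT} := HB.pack f (GRing.isLinear.Build _ _ _ _ f lf).
exact: (lfunE F).
Qed.

(** Frees the trace from the arbitrary basis [vbasis]: expanding in both systems and exchanging the
    sums is tr(AB) = tr(BA) for the coordinate changes. *)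
Lemma lftraceE (K : fieldType) (V : vectType K) (I : finType) (e : I -> V)
    (phi : I -> 'Hom(V, K^o)) (f : 'End(V)) :
  (forall v, v = \sum_i phi i v *: e i) -> lftrace f = \sum_i (phi i (f (e i)) : K).
Proof.
move=> ephi; pose b := vbasis {:V}; have bb : basis_of {:V} b := vbasisP _.
have exp v : v = \sum_k coord b k v *: b`_k.
  by apply: coord_basis bb _; apply: memvf.
transitivity (\sum_(k < \dim {:V}) coord b k (f b`_k)).
  rewrite /lftrace /mxtrace; apply: eq_bigr => k _.
  rewrite /passmx.mxof mxE /= /passmx.rVof mxE.
  congr (coord _ _ (f _)); rewrite /passmx.vecof (bigD1 k) //= mxE !eqxx scale1r.
  by rewrite big1 ?addr0 // => i /negPf ik; rewrite mxE eqxx ik scale0r.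
transitivity (\sum_(k < \dim {:V}) \sum_i phi i b`_k * coord b k (f (e i))).
  apply: eq_bigr => k _; rewrite {1}(ephi b`_k) linear_sum linear_sum.
  by apply: eq_bigr => i _; rewrite !linearZ.
rewrite exchange_big; apply: eq_bigr => i _ /=.
rewrite [in RHS](exp (f (e i))) linear_sum; apply: eq_bigr => k _.
by rewrite linearZ mulrC.
Qed.

Section LieLinear.
Variables (K : fieldType) (g : lieAlgType K).
Implicit Types X Y Z : g.

HB.instance Definition _ X :=
  GRing.isLinear.Build K g g _ (lie X) (lie_is_linear_right X).

Lemma lieC X Y : lie Y X = - lie X Y.
Proof.
have lDl Z : {morph (lie (s := g))^~ Z : U V / U + V}.
  by move=> U V; have := lie_is_linear_left Z 1 U V; rewrite !scale1r.
apply/eqP; rewrite -addr_eq0 -[X in _ == X](liexx (X + Y)).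
by rewrite lDl !linearD /= !liexx add0r addr0 addrC.
Qed.

End LieLinear.

Section Frame.
Variables (R : realType) (g : lieAlgType R) (Q : gen_data g).
Local Notation G := (metric Q).
Local Notation H := (torsion Q).
Implicit Types X Y Z : g.

HB.instance Definition _ X Y :=
  GRing.isLinear.Build R g R^o _ (H X Y) (three_form_linear3 H X Y).

Lemma metricC X Y : G X Y = G Y X.
Proof. by rewrite hermC expr0 mul1r. Qed.

Lemma torsionC12 X Y Z : H Y X Z = - H X Y Z.
Proof.
have D1 U V W : H (U + V) W Z = H U W Z + H V W Z.
  by have := three_form_linear1 H W Z 1 U V; rewrite scale1r mul1r.
have D2 U V W : H W (U + V) Z = H W U Z + H W V Z.
  by have := three_form_linear2 H W Z 1 U V; rewrite scale1r mul1r.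
apply/eqP; rewrite -addr_eq0 -[X in _ == X](three_form_alt12 H (X + Y) Z).
by rewrite D1 !D2 !three_form_alt12 add0r addr0 addrC.
Qed.

Lemma torsionC23 X Y Z : H X Z Y = - H X Y Z.
Proof.
have D2 U V W : H X (U + V) W = H X U W + H X V W.
  by have := three_form_linear2 H X W 1 U V; rewrite scale1r mul1r.
apply/eqP; rewrite -addr_eq0 -[X in _ == X](three_form_alt23 H X (Y + Z)).
by rewrite D2 !linearD /= !three_form_alt23 add0r addr0 addrC.
Qed.

Lemma flatE X Y : flat Q X Y = G X Y :> R.
Proof.
rewrite /flat linfun_linearE; last first.
  move=> a U V; apply/lfunP => W; rewrite add_lfunE scale_lfunE.
  rewrite !linfun_linearE => [|b S T|b S T|b S T]; rewrite ?linearPr //=.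
  by rewrite linearPl.
by rewrite linfun_linearE // => b S T; rewrite linearPr.
Qed.

Lemma ce1E (xi : dual g) X Y : ce1 xi X Y = - xi (lie X Y) :> R.
Proof.
rewrite /ce1 linfun_linearE // => b S T.
by rewrite linearP /= linearP opprD scalerN.
Qed.

Lemma torsion_linear1 a U V Y Z : H (a *: U + V) Y Z = a * H U Y Z + H V Y Z.
Proof. exact: three_form_linear1. Qed.
Lemma torsion_linear2 a U V X Z : H X (a *: U + V) Z = a * H X U Z + H X V Z.
Proof. exact: three_form_linear2. Qed.

Lemma torsion_lfunE X Y Z : linfun (fun Z => H X Y Z : R^o) Z = H X Y Z.
Proof. by rewrite linfun_linearE // => a U V; rewrite linearP. Qed.

Lemma orthonormal4P (e : 4.-tuple g) :
  reflect (forall i j : 'I_4, G e`_i e`_j = (i == j)%:R) (orthonormal G e).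
Proof.
case: e => [[|a [|b [|c [|d [|]]]]] //= _].
rewrite /orthonormal /= !andbT; apply: (iffP idP).
  move=> /andP[/and4P[/eqP aa /eqP bb /eqP cc /eqP dd]].
  move=> /and3P[/and3P[/eqP ab /eqP ac /eqP ad] /andP[/eqP bc /eqP bd] /eqP cd].
  do 2![apply: forall_ord4] => //=;
    by rewrite metricC ?(ab, ac, ad, bc, bd, cd) ?(aa, bb, cc, dd).
move=> on; have := on 0 0; have := on 1 1; have := on 2 2; have := on 3 3.
have := on 0 1; have := on 0 2; have := on 0 3; have := on 1 2; have := on 1 3.
by have := on 2 3; rewrite /= => -> -> -> -> -> -> -> -> -> ->; rewrite !eqxx.
Qed.

Lemma orthonormal_basis4 (e : 4.-tuple g) : \dim {:g} = 4 ->
  (forall i j : 'I_4, G e`_i e`_j = (i == j)%:R) -> orthonormal_basis Q e.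
Proof.
move=> dg on; apply/andP; split; last exact/orthonormal4P.
rewrite basisEfree subvf dg size_tuple leqnn !andbT; apply/freeP => k k0 i.
transitivity (G e`_i (\sum_(i < 4) k i *: e`_i)); last by rewrite k0 linear0r.
rewrite linear_sumr (bigD1 i) //= linearZr_LR /= on eqxx mulr1 big1 ?addr0 //.
by move=> j /negPf ji; rewrite linearZr_LR /= on eq_sym ji mulr0.
Qed.

Variable e : 4.-tuple g.
Hypothesis oe : orthonormal_basis Q e.

Lemma frameG (i j : 'I_4) : G e`_i e`_j = (i == j)%:R.
Proof. by have /andP[_ /orthonormal4P] := oe. Qed.

Lemma frame_coord i X : coord e i X = G X e`_i.
Proof.
have /andP[be _] := oe.
rewrite metricC [in RHS](coord_basis be (memvf X)) linear_sumr /=.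
rewrite (bigD1 i) //= linearZr_LR /= frameG eqxx mulr1 big1 ?addr0 // => j /negPf ji.
by rewrite linearZr_LR /= frameG eq_sym ji mulr0.
Qed.

Lemma frame_exp X : X = \sum_(i < 4) G X e`_i *: e`_i.
Proof.
have /andP[be _] := oe.
rewrite [LHS](coord_basis be (memvf X)); apply: eq_bigr => i _.
by rewrite frame_coord.
Qed.

Lemma flat_expE (xi : dual g) :
  xi = flat Q (\sum_(i < 4) (xi e`_i : R) *: e`_i).
Proof.
apply/lfunP => X; rewrite [in LHS](frame_exp X) flatE metricC linear_sumr linear_sum.
by apply: eq_bigr => i _; rewrite linearZ linearZr_LR /= mulrC.
Qed.

Lemma sharpE (xi : dual g) : sharp Q xi = \sum_(i < 4) (xi e`_i : R) *: e`_i.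
Proof.
have flat_inj : lker (flat Q) == 0%VS.
  apply/lker0P => X Y XY; rewrite [LHS]frame_exp [RHS]frame_exp.
  by apply: eq_bigr => i _; rewrite -!flatE XY.
by rewrite {1}(flat_expE xi) /sharp lker0_lfunK.
Qed.

Lemma sharpK (xi : dual g) : flat Q (sharp Q xi) = xi.
Proof. by rewrite sharpE -flat_expE. Qed.

Lemma gen_metricE X (xi : dual g) : gen_metric Q (X, xi) = (sharp Q xi, flat Q X).
Proof. by rewrite /gen_metric linfun_linearE // => a U V /=; rewrite !linearP. Qed.

Definition plus_lift X : gtangent g := (X, flat Q X).
Definition minus_lift X : gtangent g := (X, - flat Q X).

Lemma plus_in X : plus_lift X \in Eplus Q.
Proof.
apply/memv_imgP; exists X; first exact: memvf.
by rewrite linfun_linearE // => a U V; rewrite linearP.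
Qed.

Lemma minus_in X : minus_lift X \in Eminus Q.
Proof.
apply/memv_imgP; exists X; first exact: memvf.
rewrite linfun_linearE // => a U V; congr (_, _).
by rewrite linearP /= scalerN opprD.
Qed.

Lemma EplusP (u : subvs_of (Eplus Q)) : exists X, vsval u = plus_lift X.
Proof.
have /memv_imgP[X _ ->] := subvsP u; exists X.
by rewrite linfun_linearE // => a U V; rewrite linearP.
Qed.

Lemma EminusP (u : subvs_of (Eminus Q)) : exists X, vsval u = minus_lift X.
Proof.
have /memv_imgP[X _ ->] := subvsP u; exists X.
rewrite linfun_linearE // => a U V; congr (_, _).
by rewrite linearP /= scalerN opprD.
Qed.

(** By the Koszul formula, [cplus Y X Z] is g(D_Y X, Z) for D the Levi-Civita connection plus H/2,
    and [cminus] is the same with minus H/2: the metric connections with torsion H and -H. *)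
Definition cplus Y X Z :=
  (G (lie Y X) Z - G (lie X Z) Y + G (lie Z Y) X + H Y X Z) / 2.
Definition cminus X Y Z :=
  (G (lie X Y) Z - G (lie Y Z) X + G (lie Z X) Y - H X Y Z) / 2.

Lemma dorfmanE X Y :
  dorfman Q (plus_lift X) (minus_lift Y) = (lie X Y,
    ce1 (- flat Q Y) X - ce1 (flat Q X) Y + linfun (fun Z => H X Y Z : R^o)).
Proof. by []. Qed.

Lemma dorfman_linear_right u : linear (dorfman Q u).
Proof.
move=> a v w; rewrite /dorfman /=; congr (_, _); first by rewrite linearP.
apply/lfunP => Z.
rewrite !(add_lfunE, opp_lfunE, scale_lfunE) !ce1E !(add_lfunE, scale_lfunE).
rewrite !torsion_lfunE lie_is_linear_left !linearP /= (torsionC23 _ Z).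
rewrite linearP /= !(torsionC23 _ Z _) -[_ *: _]/(a * _) -![a *: _]/(a * _).
by ring.
Qed.

Lemma dorfmanC X Y :
  dorfman Q (minus_lift Y) (plus_lift X) = - dorfman Q (plus_lift X) (minus_lift Y).
Proof.
rewrite /dorfman /=; congr (_, _); first exact: lieC.
apply/lfunP => Z; rewrite !(add_lfunE, opp_lfunE) !ce1E.
by rewrite !torsion_lfunE (torsionC12 X Y) /=; ring.
Qed.

Lemma dorfman2E X Y Z : (dorfman Q (plus_lift X) (minus_lift Y)).2 Z =
  G (lie X Z) Y + G (lie Y Z) X + H X Y Z.
Proof.
rewrite dorfmanE /= !(add_lfunE, opp_lfunE) !ce1E !(opp_lfunE, flatE).
by rewrite torsion_lfunE (metricC Y) (metricC X) !opprK.
Qed.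

Lemma pi_plusE (u : gtangent g) :
  pi_plus Q u = plus_lift (2^-1 *: (u.1 + sharp Q u.2)).
Proof.
case: u => X xi; rewrite /pi_plus scale_lfunE add_lfunE id_lfunE gen_metricE /plus_lift.
by congr (_, _); rewrite [in RHS]linearZ [in RHS]linearD /= sharpK addrC.
Qed.

Lemma pi_minusE (u : gtangent g) :
  pi_minus Q u = minus_lift (2^-1 *: (u.1 - sharp Q u.2)).
Proof.
case: u => X xi.
rewrite /pi_minus scale_lfunE add_lfunE opp_lfunE id_lfunE gen_metricE /minus_lift.
by congr (_, _); rewrite [in RHS]linearZ [in RHS]linearB /= sharpK -scalerN opprB.
Qed.

Lemma plus_linear : linear plus_lift.
Proof. by move=> a U V; rewrite /plus_lift linearP. Qed.
Lemma minus_linear : linear minus_lift.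
Proof.
by move=> a U V; rewrite /minus_lift linearP opprD -scalerN.
Qed.
HB.instance Definition _ := GRing.isLinear.Build R g (gtangent g) _ plus_lift plus_linear.
HB.instance Definition _ := GRing.isLinear.Build R g (gtangent g) _ minus_lift minus_linear.

(** The sign arises because [cplus Y X] describes the bracket in the opposite order, E_- before
    E_+. *)
Lemma pi_plus_dorfman X Y : pi_plus Q (dorfman Q (plus_lift X) (minus_lift Y)) =
  - \sum_(k < 4) cplus Y X e`_k *: plus_lift e`_k.
Proof.
rewrite pi_plusE -sumrN {1}[_ + _]addrC {1}(frame_exp (dorfman Q _ _).1) sharpE.
rewrite -big_split /= scaler_sumr linear_sum; apply: eq_bigr => k _.
rewrite dorfman2E -scalerDl scalerA linearZ -scaleNr; congr (_ *: _).
rewrite /cplus (lieC X Y) (lieC Y e`_k) !linearNl (torsionC12 X Y).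
by field.
Qed.

Lemma pi_minus_dorfman X Y : pi_minus Q (dorfman Q (plus_lift X) (minus_lift Y)) =
  \sum_(k < 4) cminus X Y e`_k *: minus_lift e`_k.
Proof.
rewrite pi_minusE {1}(frame_exp (dorfman Q _ _).1) sharpE.
rewrite -sumrB /= scaler_sumr linear_sum; apply: eq_bigr => k _.
rewrite dorfman2E -scalerBl scalerA linearZ; congr (_ *: _).
rewrite /cminus (lieC X e`_k) !linearNl.
by field.
Qed.

Lemma ricci_trace X Y (u : subvs_of (Eplus Q)) (v : subvs_of (Eminus Q)) :
  vsval u = plus_lift X -> vsval v = minus_lift Y ->
  lftrace (Gamma_minus v \o Gamma_plus u)%VF =
  \sum_(k < 4) \sum_(l < 4) cminus e`_k Y e`_l * cplus e`_l X e`_k.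
Proof.
move=> uX vY.
pose em (l : 'I_4) := vsproj (Eminus Q) (minus_lift e`_l).
pose ep (k : 'I_4) := vsproj (Eplus Q) (plus_lift e`_k).
have emE l : vsval (em l) = minus_lift e`_l by rewrite vsprojK ?minus_in.
have epE l : vsval (ep l) = plus_lift e`_l by rewrite vsprojK ?plus_in.
pose phi (l : 'I_4) : 'Hom(subvs_of (Eminus Q), R^o) :=
  linfun (fun w => G (vsval w).1 e`_l : R^o).
have phiE l w : phi l w = G (vsval w).1 e`_l :> R.
  by rewrite /phi linfun_linearE // => a S T; rewrite linearP /= linearPl.
have expand w : w = \sum_l phi l w *: em l.
  apply: subvs_inj; rewrite linear_sum /=; have [W wW] := EminusP w.
  rewrite wW {1}(frame_exp W) linear_sum; apply: eq_bigr => l _.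
  by rewrite !linearZ /= emE phiE wW.
have GpE l : Gamma_plus u (em l) = - \sum_(k < 4) cplus e`_l X e`_k *: ep k.
  rewrite /Gamma_plus linfun_linearE; last first.
    by move=> a S T; rewrite linearP /= dorfman_linear_right !linearP.
  rewrite uX emE pi_plus_dorfman linearN linear_sum; congr (- _).
  by apply: eq_bigr => k _; rewrite linearZ.
have GmE k : Gamma_minus v (ep k) = - \sum_(l < 4) cminus e`_k Y e`_l *: em l.
  rewrite /Gamma_minus linfun_linearE; last first.
    by move=> a S T; rewrite linearP /= dorfman_linear_right !linearP.
  rewrite vY epE dorfmanC linearN /= pi_minus_dorfman linearN linear_sum; congr (- _).
  by apply: eq_bigr => l _; rewrite linearZ.
rewrite (lftraceE _ expand) exchange_big; apply: eq_bigr => l _.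
have phiGm k : phi l (Gamma_minus v (ep k)) = - cminus e`_k Y e`_l :> R.
  rewrite GmE linearN (linear_sum (phi l)) (bigD1 l) //= linearZ /=.
  rewrite phiE emE frameG eqxx big1 => [|m /negPf ml].
    by rewrite addr0 -[_ *: _]/(_ * _) mulr1.
  by rewrite linearZ /= phiE emE frameG ml -[_ *: _]/(_ * _) mulr0.
rewrite comp_lfunE GpE linearN linear_sum linearN (linear_sum (phi l)) -sumrN.
apply: eq_bigr => k _; rewrite !linearZ /= phiGm -[_ *: _]/(_ * _).
by ring.
Qed.

Lemma RicciPlusE X Y (u : subvs_of (Eplus Q)) (v : subvs_of (Eminus Q)) :
  vsval u = plus_lift X -> vsval v = minus_lift Y ->
  RicciPlus v u = - \sum_(k < 4) \sum_(l < 4) cminus e`_k Y e`_l * cplus e`_l X e`_k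
    + \sum_(k < 4) cplus Y X e`_k * divergence Q (plus_lift e`_k).
Proof.
move=> uX vY; rewrite /RicciPlus (ricci_trace uX vY) uX vY; congr (_ + _).
rewrite dorfmanC linearN /= pi_plus_dorfman opprK linear_sum.
by apply: eq_bigr => k _; rewrite linearZ.
Qed.

Lemma RicciMinusE X Y (u : subvs_of (Eplus Q)) (v : subvs_of (Eminus Q)) :
  vsval u = plus_lift X -> vsval v = minus_lift Y ->
  RicciMinus u v = - \sum_(k < 4) \sum_(l < 4) cminus e`_k Y e`_l * cplus e`_l X e`_k
    + \sum_(k < 4) cminus X Y e`_k * divergence Q (minus_lift e`_k).
Proof.
move=> uX vY; rewrite /RicciMinus (ricci_trace uX vY) uX vY; congr (_ + _).
rewrite pi_minus_dorfman linear_sum.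
by apply: eq_bigr => k _; rewrite linearZ.
Qed.

Definition struct_const (i j k : 'I_4) := G (lie e`_i e`_j) e`_k.
Definition torsion_const (i j k : 'I_4) := H e`_i e`_j e`_k.
Local Notation c := struct_const.
Local Notation h := torsion_const.

Lemma struct_constC i j k : c j i k = - c i j k.
Proof. by rewrite /c lieC linearNl. Qed.
Lemma torsion_constC12 i j k : h j i k = - h i j k.
Proof. exact: torsionC12. Qed.
Lemma torsion_constC23 i j k : h i k j = - h i j k.
Proof. exact: torsionC23. Qed.

Lemma lie_expand X (k : 'I_4) : lie X e`_k = \sum_(m < 4) G X e`_m *: lie e`_m e`_k.
Proof.
rewrite [LHS]lieC [in LHS](frame_exp X) linear_sum -sumrN; apply: eq_bigr => m _.
by rewrite linearZ /= (lieC e`_m) scalerN opprK.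
Qed.

Lemma torsion_expand X Y Z : H X Y Z = \sum_(m < 4) G X e`_m * H e`_m Y Z.
Proof.
rewrite [LHS]torsionC12 torsionC23 opprK [in LHS](frame_exp X) linear_sum.
by apply: eq_bigr => m _; rewrite linearZ /= torsionC23 torsionC12 opprK.
Qed.

Lemma str_expand X (k l : 'I_4) : G (lie X e`_k) e`_l = \sum_(m < 4) G X e`_m * c m k l.
Proof.
rewrite lie_expand metricC linear_sumr; apply: eq_bigr => m _.
by rewrite linearZr_LR /= (metricC e`_l).
Qed.

Lemma lie_frame (i j : 'I_4) : lie e`_i e`_j = \sum_(k < 4) c i j k *: e`_k.
Proof. exact: frame_exp. Qed.

Lemma str_jacobi i j k l : \sum_m jacobi_term c i j k l m = 0.
Proof.
transitivity (G (lie (lie e`_i e`_j) e`_k + lie (lie e`_j e`_k) e`_i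
    + lie (lie e`_k e`_i) e`_j) e`_l).
  by rewrite !linearDl /= !str_expand -!big_split.
rewrite (lieC e`_k) (lieC e`_i (lie e`_j e`_k)) (lieC e`_j (lie e`_k e`_i)).
rewrite -!opprD -addrA addrC lie_jacobi oppr0; exact: linear0l.
Qed.

Lemma tor_closed i j k l : \sum_m closed_term c h i j k l m = 0.
Proof.
rewrite -[RHS](torsion_closed Q e`_i e`_j e`_k e`_l) /ce3.
rewrite !(torsion_expand (lie _ _)).
rewrite -!sumrN -!big_split /=; apply: eq_bigr => m _.
by rewrite /closed_term /c /h; ring.
Qed.

Local Notation p k := (divergence Q (plus_lift e`_k)).
Local Notation m k := (divergence Q (minus_lift e`_k)).

Lemma gen_einstein_frame : gen_einstein Q -> forall i j,
  ricci c h i j = \sum_k conn_plus c h j i k * p k /\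
  ricci c h i j = \sum_k conn_minus c h i j k * m k.
Proof.
move=> [RP RM] i j.
pose u := vsproj (Eplus Q) (plus_lift e`_i); pose v := vsproj (Eminus Q) (minus_lift e`_j).
have uE : vsval u = plus_lift e`_i by rewrite vsprojK ?plus_in.
have vE : vsval v = minus_lift e`_j by rewrite vsprojK ?minus_in.
have := RP v u; have := RM u v; rewrite (RicciPlusE uE vE) (RicciMinusE uE vE).
by move=> /eqP + /eqP; rewrite !(addrC (- _)) !subr_eq0 => /eqP -> /eqP ->.
Qed.

Lemma frame_gen_einstein :
  (forall i j, ricci c h i j = 0) ->
  (forall i j, \sum_k conn_plus c h j i k * p k = 0) ->
  (forall i j, \sum_k conn_minus c h i j k * m k = 0) -> gen_einstein Q.
Proof.
move=> T0 P0 Q0.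
(* Every term of the Ricci curvatures is bilinear in X and Y, so vanishing on the frame suffices. *)
have bil (B : g -> g -> R) : (forall Y, scalar (B^~ Y)) -> (forall X, scalar (B X)) ->
    (forall i j : 'I_4, B e`_i e`_j = 0) -> forall X Y, B X Y = 0.
  move=> Bl Br B0 X Y.
  pose Bl' Z : {scalar g} := HB.pack (B^~ Z) (GRing.isLinear.Build _ _ _ _ (B^~ Z) (Bl Z)).
  pose Br' Z : {scalar g} := HB.pack (B Z) (GRing.isLinear.Build _ _ _ _ (B Z) (Br Z)).
  rewrite -[B X Y]/(Bl' Y X) (frame_exp X) linear_sum big1 // => i _.
  rewrite linearZ /= -[B _ _]/(Br' e`_i Y) (frame_exp Y) linear_sum big1 ?mulr0 //.
  by move=> j _; rewrite linearZ /= B0 mulr0.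
have cplus1 Y Z : scalar (fun X => cplus Y X Z).
  move=> a U V; rewrite /cplus lie_is_linear_left !linearP /= !linearPl ?linearPr.
  by rewrite torsion_linear2 /=; ring.
have cplus2 X Z : scalar (fun Y => cplus Y X Z).
  move=> a U V; rewrite /cplus lie_is_linear_left !linearP /= !linearPl ?linearPr.
  by rewrite torsion_linear1 /=; ring.
have cminus1 Y Z : scalar (fun X => cminus X Y Z).
  move=> a U V; rewrite /cminus lie_is_linear_left !linearP /= !linearPl ?linearPr.
  by rewrite torsion_linear1 /=; ring.
have cminus2 X Z : scalar (fun Y => cminus X Y Z).
  move=> a U V; rewrite /cminus lie_is_linear_left !linearP /= !linearPl ?linearPr.
  by rewrite torsion_linear2 /=; ring.
have Tr X Y :
  \sum_(k < 4) \sum_(l < 4) cminus e`_k Y e`_l * cplus e`_l X e`_k = 0.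
  apply: (bil (fun X Y => \sum_(k < 4) \sum_(l < 4)
    cminus e`_k Y e`_l * cplus e`_l X e`_k)) => [Z a U V|Z a U V|i j].
  - rewrite mulr_sumr -big_split; apply: eq_bigr => k _ /=.
    rewrite mulr_sumr -big_split; apply: eq_bigr => l _ /=.
    by rewrite cplus1 /=; ring.
  - rewrite mulr_sumr -big_split; apply: eq_bigr => k _ /=.
    rewrite mulr_sumr -big_split; apply: eq_bigr => l _ /=.
    by rewrite cminus2 /=; ring.
  - exact: T0.
split=> [v u|u v]; have [X uX] := EplusP u; have [Y vY] := EminusP v.
  rewrite (RicciPlusE uX vY) Tr oppr0 add0r.
  apply: (bil (fun X Y => \sum_(k < 4) cplus Y X e`_k * p k)) => [Z a U V|Z a U V|i j].
  - rewrite mulr_sumr -big_split; apply: eq_bigr => k _ /=.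
    by rewrite cplus1 /=; ring.
  - rewrite mulr_sumr -big_split; apply: eq_bigr => k _ /=.
    by rewrite cplus2 /=; ring.
  - exact: P0.
rewrite (RicciMinusE uX vY) Tr oppr0 add0r.
apply: (bil (fun X Y => \sum_(k < 4) cminus X Y e`_k * m k)) => [Z a U V|Z a U V|i j].
- rewrite mulr_sumr -big_split; apply: eq_bigr => k _ /=.
  by rewrite cminus1 /=; ring.
- rewrite mulr_sumr -big_split; apply: eq_bigr => k _ /=.
  by rewrite cminus2 /=; ring.
- exact: Q0.
Qed.
End Frame.

(** * Orthonormal bases *)

Section Extend.
Variables (R : realType) (g : lieAlgType R) (Q : gen_data g).
Local Notation G := (metric Q).
Hypotheses (dim4 : \dim {:g} = 4) (pos : riemannian Q).

Definition unit_vector (X : g) : g := (Num.sqrt (G X X))^-1 *: X.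

Lemma unit_vectorP X : X != 0 -> G (unit_vector X) (unit_vector X) = 1.
Proof.
move=> /pos XX; rewrite linearZl_LR linearZr_LR /= mulrA -invfM -expr2.
by rewrite sqr_sqrtr ?ltW // mulVf ?gt_eqF.
Qed.

(** The map to R^4 recording the products with the [u j], j in A, has coordinate [i0] equal to zero.
    It is not onto, hence by dimension not injective, and a kernel vector can be normalised. *)
Lemma exists_unit_ortho (A : {set 'I_4}) (u : 'I_4 -> g) i0 : i0 \notin A ->
  exists v, G v v = 1 /\ {in A, forall j, G v (u j) = 0}.
Proof.
move=> i0A; pose f (X : g) : 'rV[R]_4 := \row_j if j \in A then G X (u j) else 0.
have f_lin : linear f.
  move=> a X Y; apply/rowP => j; rewrite !mxE; case: ifP => _.
    by rewrite linearPl.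
  by rewrite mulr0 addr0.
pose F : 'Hom(g, 'rV[R]_4) := linfun f.
have FE X : F X = f X by rewrite /F linfun_linearE.
have [K0|] := eqVneq (lker F) 0%VS.
  have := limg_ker_dim F {:g}; rewrite K0 capv0 dimv0 add0n dim4 => dimF.
  have imF : limg F = fullv.
    by apply/eqP; rewrite eqEdim subvf dimF dimvf /= dim_matrix.
  have : (delta_mx 0 i0 : 'rV[R]_4) \in limg F by rewrite imF memvf.
  move=> /memv_imgP[X _]; rewrite FE => /rowP/(_ i0)/eqP.
  by rewrite !mxE !eqxx (negPf i0A) oner_eq0.
rewrite -vpick0 => v0; exists (unit_vector (vpick (lker F))); split; first exact: unit_vectorP.
move=> j jA; rewrite linearZl_LR /=.
have := memv_pick (lker F); rewrite memv_ker FE => /eqP/rowP/(_ j).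
rewrite !mxE jA => ->; exact: mulr0.
Qed.

(** Orthonormal completion that keeps the prescribed vectors at prescribed positions, by induction
    on the number of free positions; the empty set gives the existence of an orthonormal basis. *)
Lemma extend_frame (A : {set 'I_4}) (u : 'I_4 -> g) :
  {in A &, forall i j, G (u i) (u j) = (i == j)%:R} ->
  exists2 e : 4.-tuple g, orthonormal_basis Q e & {in A, forall i : 'I_4, e`_i = u i}.
Proof.
move nE : #|~: A| => n; elim: n A u nE => [|n IH] A u nE onA.
  have AT : A = setT by apply/eqP; rewrite -[A]setCK (cards0_eq nE) setC0.
  exists [tuple u i | i < 4]; last by move=> i _; rewrite -tnth_nth tnth_mktuple.
  apply: orthonormal_basis4 => // i j.
  by rewrite -!tnth_nth !tnth_mktuple onA // AT inE.
have [i0] : exists i, i \in ~: A by apply/set0Pn; rewrite -card_gt0 nE.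
rewrite inE => i0A; have [v [vv vA]] := exists_unit_ortho u i0A.
pose u' j := if j == i0 then v else u j.
have uA j : j \in A -> u' j = u j.
  by move=> jA; rewrite /u'; case: eqP jA i0A => // -> ->.
have [|i j|e oe eA'] := IH (i0 |: A) u'.
- by have := cardsC (i0 |: A); have := cardsC A; rewrite nE cardsU1 i0A /= => <-; lia.
- rewrite !inE => /orP[/eqP->|iA] /orP[/eqP->|jA].
  + by rewrite /u' !eqxx.
  + rewrite (uA j) // {1}/u' eqxx vA //.
    by case: eqP i0A jA => // <- /negPf ->.
  + rewrite (uA i) // {1}/u' eqxx metricC vA //.
    by case: eqP i0A iA => // -> /negPf ->.
  + by rewrite !uA // onA.
by exists e => // i iA; rewrite eA' ?uA // inE iA orbT.
Qed.
End Extend.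

Section Outcomes.
Variables (R : realType) (g : lieAlgType R) (Q : gen_data g).
Local Notation delta := (divergence Q).

(** The frame conditions of [family_e2], and below those of [family_so3], over an arbitrary Lie
    algebra: they are established on g and carried to the model afterwards. *)
Definition e2_frame (e : 4.-tuple g) (a : R) :=
  let e1 := e`_0 in let e2 := e`_1 in let e3 := e`_2 in let e4 := e`_3 in
  let f1 := dual_basis e 0 in let f2 := dual_basis e 1 in
  [/\ lie e3 e1 = a *: e2,
      lie e3 e2 = - a *: e1,
      [/\ lie e1 e2 = 0, lie e1 e4 = 0, lie e2 e4 = 0 & lie e3 e4 = 0],
      delta (of_vect e1) = 0 /\ delta (of_vect e2) = 0 &
      delta (of_covect f1) = 0 /\ delta (of_covect f2) = 0].

Definition so3_frame (a b eps : R) (e : 4.-tuple g) :=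
  let e1 := e`_0 in let e2 := e`_1 in let e3 := e`_2 in let e4 := e`_3 in
  let f1 := dual_basis e 0 in let f2 := dual_basis e 1 in
  let f3 := dual_basis e 2 in
  [/\ a != 0, eps = -1 \/ eps = 1 & orthonormal_basis Q e] /\
  (forall X Y Z, torsion Q X Y Z = a * wedge3 f1 f2 f3 X Y Z) /\
  [/\ lie e1 e2 = (eps * a) *: e3,
      lie e2 e3 = (eps * a) *: e1,
      lie e3 e1 = (eps * a) *: e2 &
      [/\ lie e3 e4 = b *: e2, lie e4 e2 = b *: e3 & lie e1 e4 = 0]] /\
  (b != 0 ->
    delta (of_vect e1) = - eps * delta (of_covect f1) /\
    {in <<[:: of_vect e2; of_vect e3; of_covect f2; of_covect f3]>>%VS,
       forall u, delta u = 0}) /\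
  (b = 0 ->
    [/\ delta (of_vect e1) = - eps * delta (of_covect f1),
        delta (of_vect e2) = - eps * delta (of_covect f2) &
        delta (of_vect e3) = - eps * delta (of_covect f3)]).
End Outcomes.

Section FrameFacts.
Variables (R : realType) (g : lieAlgType R) (Q : gen_data g).
Local Notation G := (metric Q).
Local Notation H := (torsion Q).
Local Notation delta := (divergence Q).
Variable e : 4.-tuple g.
Hypothesis oe : orthonormal_basis Q e.
Local Notation c := (struct_const Q e).
Local Notation h := (torsion_const Q e).

Lemma flat_dual_basis (i : 'I_4) : flat Q e`_i = dual_basis e i.
Proof.
apply/lfunP => X; rewrite flatE metricC /dual_basis linfun_linearE.
  by rewrite (frame_coord oe).
by move=> a U V; rewrite linearP.
Qed.

Lemma divergence_plus (i : 'I_4) : delta (plus_lift Q e`_i) =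
  delta (of_vect e`_i) + delta (of_covect (dual_basis e i)).
Proof.
rewrite -linearD /plus_lift flat_dual_basis /of_vect /of_covect.
by congr (delta _); congr (_, _); rewrite ?addr0 ?add0r.
Qed.

Lemma divergence_minus (i : 'I_4) : delta (minus_lift Q e`_i) =
  delta (of_vect e`_i) - delta (of_covect (dual_basis e i)).
Proof.
rewrite -linearB /minus_lift flat_dual_basis /of_vect /of_covect.
by congr (delta _); congr (_, _); rewrite ?subr0 ?sub0r.
Qed.

Lemma divergence_eq0 (i : 'I_4) :
  delta (plus_lift Q e`_i) = 0 -> delta (minus_lift Q e`_i) = 0 ->
  delta (of_vect e`_i) = 0 /\ delta (of_covect (dual_basis e i)) = 0.
Proof. by rewrite divergence_plus divergence_minus => p m; split; lra. Qed.

Lemma torsion_expand3 X Y Z : H X Y Z =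
  \sum_(i < 4) \sum_(j < 4) \sum_(k < 4) G X e`_i * G Y e`_j * G Z e`_k * h i j k.
Proof.
rewrite (torsion_expand oe); apply: eq_bigr => i _.
rewrite torsionC12 (torsion_expand oe) -sumrN mulr_sumr; apply: eq_bigr => j _.
rewrite torsionC23 torsionC12 opprK (torsion_expand oe) mulr_sumr -sumrN mulr_sumr.
apply: eq_bigr => k _.
by rewrite torsionC23 torsionC12 torsionC23 !opprK /torsion_const; ring.
Qed.

Lemma lie_expand2 X Y : lie X Y =
  \sum_(i < 4) \sum_(j < 4) (G X e`_i * G Y e`_j) *: lie e`_i e`_j.
Proof.
rewrite exchange_big [in LHS](frame_exp oe Y) linear_sum; apply: eq_bigr => j _.
rewrite linearZ /= (lie_expand oe) scaler_sumr; apply: eq_bigr => i _.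
by rewrite scalerA mulrC.
Qed.

Lemma span_perp (y : 'I_4 -> R) : (forall i j, \sum_k c i j k * y k = 0) ->
  forall U V, G (lie U V) (\sum_k y k *: e`_k) = 0.
Proof.
move=> cy U V; rewrite metricC lie_expand2 linear_sumr big1 // => i _.
rewrite linear_sumr big1 // => j _; rewrite linearZr_LR /=.
rewrite [X in _ * X]metricC linear_sumr.
rewrite (eq_bigr (fun k => c i j k * y k)) ?cy ?mulr0 // => k _.
by rewrite linearZr_LR /= mulrC.
Qed.

Lemma metric_span (y : 'I_4 -> R) (i : 'I_4) : G (\sum_k y k *: e`_k) e`_i = y i.
Proof.
rewrite metricC linear_sumr (bigD1 i) //= linearZr_LR /= frameG // eqxx mulr1.
rewrite big1 ?addr0 // => j /negPf ji.
by rewrite linearZr_LR /= frameG // eq_sym ji mulr0.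
Qed.

Lemma dual_basisE (i : 'I_4) X : dual_basis e i X = G X e`_i :> R.
Proof. by rewrite -flat_dual_basis flatE metricC. Qed.

Lemma wedge3E X Y Z :
  wedge3 (dual_basis e 0) (dual_basis e 1) (dual_basis e 2) X Y Z =
  G X e`_0 * (G Y e`_1 * G Z e`_2 - G Y e`_2 * G Z e`_1)
  - G Y e`_0 * (G X e`_1 * G Z e`_2 - G X e`_2 * G Z e`_1)
  + G Z e`_0 * (G X e`_1 * G Y e`_2 - G X e`_2 * G Y e`_1).
Proof.
rewrite /wedge3 (expand_det_row _ 0) !big_ord_recl big_ord0 /cofactor.
rewrite !(expand_det_row _ 0) !big_ord_recl !big_ord0 /cofactor.
rewrite !det_mx11 !mxE /= !dual_basisE /= /bump /=.
by ring.
Qed.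

Lemma torsion_wedge3 : (forall i j, h i j 3 = 0) -> forall X Y Z,
  H X Y Z = h 0 1 2 * wedge3 (dual_basis e 0) (dual_basis e 1) (dual_basis e 2) X Y Z.
Proof.
move=> h3 X Y Z.
have C12 i j k := torsion_constC12 Q e i j k; have C23 i j k := torsion_constC23 Q e i j k.
have h3' i j : h 3 i j = 0 by rewrite C12 C23 C12 h3 !oppr0.
have h3'' i j : h i 3 j = 0 by rewrite C23 h3 oppr0.
have h01 := skew12_eq0 C12; have h02 := skew13_eq0 C12 C23; have h03 := skew23_eq0 C23.
have h120 : h 1 2 0 = h 0 1 2 by rewrite C23 C12 opprK.
have h201 : h 2 0 1 = h 0 1 2 by rewrite C12 C23 opprK.
rewrite torsion_expand3 !sum_ord4 !(h01, h02, h03, h3, h3', h3'').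
rewrite h120 h201 (C12 0 1) (C12 1 2) (C12 2 0) h120 h201 wedge3E /=.
by ring.
Qed.

Lemma tor_eq0 : (forall i j k, h i j k = 0) -> forall X Y Z, H X Y Z = 0.
Proof.
move=> h0 X Y Z; rewrite torsion_expand3 big1 // => i _; rewrite big1 // => j _.
by rewrite big1 // => k _; rewrite h0 mulr0.
Qed.

Hypothesis ein : gen_einstein Q.

Lemma ricci0 i j : ricci c h i j = 0.
Proof.
apply: (ricci_eq0 (@struct_constC _ _ _ _) (@torsion_constC12 _ _ _ _) (@torsion_constC23 _ _ _ _)
  (str_jacobi oe) (tor_closed oe)) => a b.
by have [-> _] := gen_einstein_frame oe ein a b.
Qed.

(** Once T = 0, the Einstein equations say that the restrictions of the divergence to E_+ and E_-,
    viewed as covectors on g, are parallel for the connections [cplus] and [cminus]. *)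
Lemma plus_parallel i j : \sum_k conn_plus c h j i k * delta (plus_lift Q e`_k) = 0.
Proof. by have [<- _] := gen_einstein_frame oe ein i j; apply: ricci0. Qed.

Lemma minus_parallel i j : \sum_k conn_minus c h i j k * delta (minus_lift Q e`_k) = 0.
Proof. by have [_ <-] := gen_einstein_frame oe ein i j; apply: ricci0. Qed.

Lemma str_trace k : \sum_i c k i i = 0.
Proof.
exact: (trace_eq0 (@struct_constC _ _ _ _) (@torsion_constC12 _ _ _ _) (@torsion_constC23 _ _ _ _)
  (str_jacobi oe) ricci0).
Qed.
End FrameFacts.

(** * Adapted orthonormal bases of Einstein Lie algebras *)

Section Classification.
Variables (R : realType) (g : lieAlgType R) (Q : gen_data g).
Local Notation G := (metric Q).
Local Notation H := (torsion Q).
Local Notation delta := (divergence Q).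
Hypotheses (dim4 : \dim {:g} = 4) (pos : riemannian Q) (ein : gen_einstein Q).

Definition perp (X : g) := forall U V, G (lie U V) X = 0.

Lemma perpZ a X : perp X -> perp (a *: X).
Proof. by move=> pX U V; rewrite linearZr_LR /= pX mulr0. Qed.

Lemma frame_neq0 (e : 4.-tuple g) (y : 'I_4 -> R) i : orthonormal_basis Q e ->
  y i != 0 -> \sum_k y k *: e`_k != 0.
Proof.
move=> oe; apply: contraNneq => y0; rewrite -(metric_span oe y i) y0.
by rewrite linear0l.
Qed.

Lemma frame_skew (e : 4.-tuple g) (oe : orthonormal_basis Q e) (a : 'I_4) :
  perp e`_a -> forall k l, struct_const Q e a l k = - struct_const Q e a k l.
Proof.
move=> pa; apply: (perp_basis (@struct_constC _ _ _ _) (@torsion_constC12 _ _ _ _)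
  (@torsion_constC23 _ _ _ _) (ricci0 oe ein) _).1 => i j; exact: pa.
Qed.

Lemma exists_perp : exists2 X, perp X & G X X = 1.
Proof.
have [|e oe _] := @extend_frame _ _ Q dim4 pos set0 (fun=> 0).
  by move=> i j; rewrite inE.
have [x [i xi] cx] := perp_exists (@struct_constC _ _ Q e) (str_jacobi oe) (str_trace oe ein).
exists (unit_vector Q (\sum_k x k *: e`_k)); last exact: unit_vectorP (frame_neq0 oe xi).
by apply: perpZ; apply: span_perp.
Qed.

Lemma frame_with2 (a b : 'I_4) X Y : a != b -> G X X = 1 -> G Y Y = 1 ->
  G X Y = 0 -> exists e : 4.-tuple g, [/\ orthonormal_basis Q e, e`_a = X & e`_b = Y].
Proof.
move=> ab XX YY XY.
have [|e oe eE] := @extend_frame _ _ Q dim4 pos [set a; b]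
    (fun i => if i == a then X else Y).
  move=> i j; rewrite !inE => /orP[]/eqP-> /orP[]/eqP->;
    by rewrite ?eqxx // ?(negPf ab) ?[b == a]eq_sym ?(negPf ab) // metricC.
exists e; split=> //; first by rewrite eE ?eqxx // !inE eqxx.
by rewrite eE ?[b == a]eq_sym ?(negPf ab) // !inE eqxx orbT.
Qed.

(* The skew map ad e_4 of the three-dimensional orthogonal of e_4 is singular. *)
Lemma exists_perp_frame : exists e : 4.-tuple g,
  [/\ orthonormal_basis Q e, perp e`_3 & lie e`_3 e`_0 = 0].
Proof.
have [X pX XX] := exists_perp.
have [|e oe e3] := @extend_frame _ _ Q dim4 pos [set 3] (fun=> X).
  by move=> i j; rewrite !inE => /eqP-> /eqP->; rewrite eqxx.
have {}e3 : e`_3 = X by rewrite -(e3 3) // inE.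
have p3 : perp e`_3 by rewrite e3.
pose c := struct_const Q e; have s3 : forall k l, c 3 l k = - c 3 k l := @frame_skew e oe 3 p3.
have c3 i j : c i j 3 = 0 by apply: p3.
(* The axis of the skew map ad e_3 on the orthogonal of e_3. If it is zero then so is the map, and
   any vector of that space can serve. *)
pose y (k : 'I_4) : R := [:: c 3 1 2; c 3 2 0; c 3 0 1; 0]`_k.
have lieE (z : 'I_4 -> R) : lie e`_3 (\sum_k z k *: e`_k) =
    \sum_l (\sum_k z k * c 3 k l) *: e`_l.
  rewrite linear_sum (eq_bigr (fun k => \sum_l (z k * c 3 k l) *: e`_l)).
    by rewrite exchange_big; apply: eq_bigr => l _; rewrite scaler_suml.
  move=> k _; rewrite linearZ /= [lie _ _](lie_frame oe 3 k) scaler_sumr.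
  by apply: eq_bigr => l _; rewrite scalerA.
have s0 k : c 3 k k = 0.
  by apply/eqP; rewrite -[_ == _](mulrn_eq0 _ 2) mulr2n {1}s3 addNr.
have c33 k : c 3 3 k = 0 by rewrite s3 c3 oppr0.
have [z [zN0 z3 zc]] : exists z : 'I_4 -> R,
    [/\ exists i, z i != 0, z 3 = 0 & forall l, \sum_k z k * c 3 k l = 0].
  have [/existsP yN0|] := boolP [exists i, y i != 0].
    exists y; split=> //; apply: forall_ord4; rewrite sum_ord4 /y /= ?s0 ?c33 ?c3.
    - by rewrite (s3 0 1); ring.
    - by rewrite (s3 1 2); ring.
    - by rewrite (s3 2 0); ring.
    - by ring.
  rewrite negb_exists => /forallP y0.
  have y0' i : y i = 0 by apply/eqP; rewrite -[_ == _]negbK.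
  exists (fun k => (k == 0)%:R); split=> //; first by exists 0; rewrite oner_eq0.
  have := y0' 0; have := y0' 1; have := y0' 2; rewrite /y /= => h2 h1 h0.
  apply: forall_ord4; rewrite sum_ord4 /= ?s0 ?c33 ?c3 !mul0r !addr0 ?mul1r //.
  by rewrite s3 h1 oppr0.
case: zN0 => i zi; pose Y := \sum_k z k *: e`_k.
have [||||e' [oe' e'3 e'0]] := @frame_with2 3 0 X (unit_vector Q Y).
- by [].
- by [].
- exact: unit_vectorP (frame_neq0 oe zi).
- by rewrite /unit_vector linearZr_LR -e3 /= [G e`_3 _]metricC (metric_span oe z 3) z3 mulr0.
exists e'; split=> //; first by rewrite e'3.
rewrite e'0 e'3 -e3 /unit_vector linearZ /= lieE big1 ?scaler0 // => l _.
by rewrite zc scale0r.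
Qed.

Section Perp3Frame.
Variable e : 4.-tuple g.
Hypotheses (oe : orthonormal_basis Q e) (p3 : perp e`_3) (l30 : lie e`_3 e`_0 = 0).
Local Notation c := (struct_const Q e).
Local Notation h := (torsion_const Q e).

Let nf := perp3_nf (@struct_constC _ _ Q e) (@torsion_constC12 _ _ Q e) (@torsion_constC23 _ _ Q e)
  (str_trace oe ein) (ricci0 oe ein) (fun i j : 'I_4 => p3 e`_i e`_j).
Let c30 k : c 3 0 k = 0. Proof. by rewrite /struct_const l30 linear0l. Qed.
Let c32 : c 3 2 0 = 0.
Proof. by have := c30 2; rewrite nf => /eqP; rewrite oppr_eq0 => /eqP. Qed.

Lemma perp3_lie :
  [/\ lie e`_0 e`_1 = c 1 2 2 *: e`_0 + c 2 0 2 *: e`_1 + c 0 1 2 *: e`_2,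
      lie e`_1 e`_2 = c 1 2 0 *: e`_0 + c 1 2 1 *: e`_1 + c 1 2 2 *: e`_2 &
      lie e`_2 e`_0 = c 1 2 1 *: e`_0 + c 2 0 1 *: e`_1 + c 2 0 2 *: e`_2] /\
  (lie e`_3 e`_1 = c 3 1 2 *: e`_2 /\ lie e`_2 e`_3 = c 3 1 2 *: e`_1).
Proof.
split; split.
- by rewrite [LHS](lie_frame oe 0 1) sum_ord4 !nf scale0r addr0.
- by rewrite [LHS](lie_frame oe 1 2) sum_ord4 !nf scale0r addr0.
- by rewrite [LHS](lie_frame oe 2 0) sum_ord4 !nf scale0r addr0.
- rewrite [LHS](lie_frame oe 3 1) sum_ord4 !nf c30 !(scale0r, oppr0, addr0) add0r.
  by [].
rewrite [LHS](lie_frame oe 2 3) sum_ord4 !nf c32 opprK.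
by rewrite !(scale0r, oppr0, addr0) add0r.
Qed.

Lemma so3_outcome : h 0 1 2 != 0 ->
  so3_frame Q (h 0 1 2) (c 3 1 2) (c 0 1 2 / h 0 1 2) e.
Proof.
move=> h0; have [[l11 l00 l2] [l01 l02 l12]] :=
  perp3_so3 (@struct_constC _ _ Q e) (@torsion_constC12 _ _ Q e) (@torsion_constC23 _ _ Q e)
  (str_trace oe ein) (ricci0 oe ein) (fun i j : 'I_4 => p3 e`_i e`_j) h0.
have [[b01 b12 b20] [b31 b23]] := perp3_lie.
have epsa : c 0 1 2 / h 0 1 2 * h 0 1 2 = c 0 1 2 by rewrite divfK.
have eps1 : c 0 1 2 = - h 0 1 2 \/ c 0 1 2 = h 0 1 2.
  by move/eqP: l2; rewrite eqf_sqr => /orP[]/eqP ->; [right | left].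
pose p k := delta (plus_lift Q e`_k); pose m k := delta (minus_lift Q e`_k).
have pE i j : \sum_(k < 4) conn_plus c h j i k * p k = 0 := plus_parallel oe ein i j.
have mE i j : \sum_(k < 4) conn_minus c h i j k * m k = 0 := minus_parallel oe ein i j.
have simpl := (l11, l00, l01, l02, l12, c30, c32).
have p0 : (c 0 1 2 + h 0 1 2) * p 0 = 0.
  have := pE 2 1; rewrite sum_ord4 /conn_plus !nf !simpl => /= e0; lra.
have p1 : (c 0 1 2 + h 0 1 2) * p 1 = 0.
  have := pE 0 2; rewrite sum_ord4 /conn_plus !nf !simpl => /= e0; lra.
have p2 : (c 0 1 2 + h 0 1 2) * p 2 = 0.
  have := pE 1 0; rewrite sum_ord4 /conn_plus !nf !simpl => /= e0; lra.
have m0 : (c 0 1 2 - h 0 1 2) * m 0 = 0.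
  have := mE 1 2; rewrite sum_ord4 /conn_minus !nf !simpl => /= e0; lra.
have m1 : (c 0 1 2 - h 0 1 2) * m 1 = 0.
  have := mE 2 0; rewrite sum_ord4 /conn_minus !nf !simpl => /= e0; lra.
have m2 : (c 0 1 2 - h 0 1 2) * m 2 = 0.
  have := mE 0 1; rewrite sum_ord4 /conn_minus !nf !simpl => /= e0; lra.
have bp2 : c 3 1 2 * p 2 = 0.
  have := pE 1 3; rewrite sum_ord4 /conn_plus !nf !simpl => /= e0; lra.
have bp1 : c 3 1 2 * p 1 = 0.
  have := pE 2 3; rewrite sum_ord4 /conn_plus !nf !simpl => /= e0; lra.
have bm2 : c 3 1 2 * m 2 = 0.
  have := mE 3 1; rewrite sum_ord4 /conn_minus !nf !simpl => /= e0; lra.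
have bm1 : c 3 1 2 * m 1 = 0.
  have := mE 3 2; rewrite sum_ord4 /conn_minus !nf !simpl => /= e0; lra.
(* Since [c 0 1 2] is [h 0 1 2] or its opposite, exactly one of the two factors is nonzero: one sign
   kills [p i], the other [m i], and both cases read as the same relation with eps =
   [c 0 1 2 / h 0 1 2]. *)
have dE (i : 'I_4) : (c 0 1 2 + h 0 1 2) * p i = 0 -> (c 0 1 2 - h 0 1 2) * m i = 0 ->
    delta (of_vect e`_i) =
    - (c 0 1 2 / h 0 1 2) * delta (of_covect (dual_basis e i)).
  rewrite /p /m (divergence_plus oe) (divergence_minus oe).
  have h2 : h 0 1 2 + h 0 1 2 != 0 by rewrite -mulr2n mulrn_eq0.
  case: eps1 => -> => [_ /eqP|/eqP + _].
    rewrite -opprD mulf_eq0 oppr_eq0 (negPf h2) /= subr_eq0 => /eqP ->.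
    by rewrite !mulNr divff // mul1r opprK.
  rewrite mulf_eq0 (negPf h2) /= addr_eq0 => /eqP ->.
  by rewrite divff // mulN1r.
split; [split=> //|split; [|split; [|split]]].
- by case: eps1 => ->; rewrite ?mulNr divff //; [left | right].
- by apply: torsion_wedge3 => // i j; rewrite nf.
- rewrite b01 b12 b20 epsa !simpl !(scale0r, addr0, add0r); split=> //.
  by split=> //; rewrite lieC l30 oppr0.
- move=> b0; split; first exact: (dE 0).
  have bI z : c 3 1 2 * z = 0 -> z = 0.
    by move/eqP; rewrite mulf_eq0 (negPf b0) => /eqP.
  have z1 := bI _ bp1; have z2 := bI _ bp2.
  have w1 := bI _ bm1; have w2 := bI _ bm2.
  have [d1 d1'] := divergence_eq0 oe (i := 1) z1 w1.
  have [d2 d2'] := divergence_eq0 oe (i := 2) z2 w2.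
  move=> u us; apply/eqP; rewrite -memv_ker; move: u us; apply/subvP/span_subvP.
  by move=> u; rewrite !inE memv_ker => /or4P[]/eqP->; apply/eqP.
- by move=> _; split; [apply: (dE 0) | apply: (dE 1) | apply: (dE 2)].
Qed.

Lemma exists_perp2 : h 0 1 2 = 0 -> exists e' : 4.-tuple g,
  [/\ orthonormal_basis Q e', perp e'`_2 & perp e'`_3].
Proof.
move=> h0; have [y [[i yi] y3 yc]] := perp3_kernel (@struct_constC _ _ Q e)
  (@torsion_constC12 _ _ Q e) (@torsion_constC23 _ _ Q e) (str_jacobi oe) (str_trace oe ein)
  (ricci0 oe ein) (fun i j : 'I_4 => p3 e`_i e`_j) h0 c30.
pose Y := \sum_k y k *: e`_k.
have [||||e' [oe' e'3 e'2]] := @frame_with2 3 2 e`_3 (unit_vector Q Y).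
- by [].
- exact: (frameG oe 3 3).
- exact: unit_vectorP (frame_neq0 oe yi).
- by rewrite /unit_vector linearZr_LR /= [G e`_3 _]metricC (metric_span oe y 3) y3 mulr0.
exists e'; split=> //; last by rewrite e'3.
by rewrite e'2; apply: perpZ; apply: span_perp.
Qed.

End Perp3Frame.

Section Perp23Frame.
Variable e : 4.-tuple g.
Hypotheses (oe : orthonormal_basis Q e) (p2 : perp e`_2) (p3 : perp e`_3).
Local Notation c := (struct_const Q e).

Let flat23 := perp23_flat (@struct_constC _ _ Q e) (@torsion_constC12 _ _ Q e)
  (@torsion_constC23 _ _ Q e) (str_trace oe ein) (ricci0 oe ein) (fun i j : 'I_4 => p2 e`_i e`_j)
  (fun i j : 'I_4 => p3 e`_i e`_j).

Lemma perp23_torsion X Y Z : H X Y Z = 0.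
Proof. by have [h0 _ _ _ _] := flat23; apply: (tor_eq0 oe). Qed.

Lemma perp23_lie :
  [/\ lie e`_0 e`_1 = 0, lie e`_2 e`_3 = 0,
      lie e`_2 e`_0 = c 2 0 1 *: e`_1 /\ lie e`_2 e`_1 = - c 2 0 1 *: e`_0 &
      lie e`_3 e`_0 = c 3 0 1 *: e`_1 /\ lie e`_3 e`_1 = - c 3 0 1 *: e`_0].
Proof.
have [_ c01 c23 ca0 ca1] := flat23.
have i2 : (2 : 'I_4) \in [:: 2; 3] by rewrite inE eqxx.
have i3 : (3 : 'I_4) \in [:: 2; 3] by rewrite !inE eqxx orbT.
split.
- by rewrite [LHS](lie_frame oe 0 1) big1 // => k _; rewrite c01 scale0r.
- by rewrite [LHS](lie_frame oe 2 3) big1 // => k _; rewrite c23 scale0r.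
- rewrite [LHS](lie_frame oe 2 0) [X in _ /\ X = _](lie_frame oe 2 1) !sum_ord4.
  rewrite (ca0 2 0 i2) (ca0 2 2 i2) (ca0 2 3 i2) !(ca1 2 _ i2) /=.
  by rewrite !(mul0r, mul1r, mulN1r, oppr0, scale0r, add0r, addr0).
rewrite [LHS](lie_frame oe 3 0) [X in _ /\ X = _](lie_frame oe 3 1) !sum_ord4.
rewrite (ca0 3 0 i3) (ca0 3 2 i3) (ca0 3 3 i3) !(ca1 3 _ i3) /=.
by rewrite !(mul0r, mul1r, mulN1r, oppr0, scale0r, add0r, addr0).
Qed.

Lemma lie_frame_eq0 X : (forall i : 'I_4, lie X e`_i = 0) -> forall Y, lie X Y = 0.
Proof.
move=> X0 Y; rewrite (frame_exp oe Y) linear_sum big1 // => i _.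
by rewrite linearZ /= X0 scaler0.
Qed.

Lemma perp23_abelian : c 2 0 1 = 0 -> c 3 0 1 = 0 -> forall X Y : g, lie X Y = 0.
Proof.
have [l01 l23 [l20 l21] [l30 l31]] := perp23_lie.
move=> c2 c3 X Y; rewrite c2 oppr0 !scale0r in l20 l21.
rewrite c3 oppr0 !scale0r in l30 l31.
apply: lie_frame_eq0 => j; rewrite lieC -[RHS]oppr0; congr (- _); move: j X.
apply: forall_ord4 => X; apply: lie_frame_eq0; apply: forall_ord4;
  by rewrite ?liexx ?l01 ?l23 ?l20 ?l21 ?l30 ?l31 // lieC
    ?l01 ?l23 ?l20 ?l21 ?l30 ?l31 oppr0.
Qed.

Lemma e2_outcome : c 2 0 1 != 0 -> c 3 0 1 = 0 -> e2_frame Q e (c 2 0 1).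
Proof.
move=> a0 c30; have [l01 l23 [l20 l21] [l30 l31]] := perp23_lie.
rewrite c30 oppr0 !scale0r in l30 l31.
have [h0 _ c23 ca0 ca1] := flat23.
have i2 : (2 : 'I_4) \in [:: 2; 3] by rewrite inE eqxx.
have c02 i j : c i j 2 = 0 by apply: p2.
have c20 : c 2 0 0 = 0 by rewrite (ca0 2 _ i2) mul0r.
have c21 : c 2 1 1 = 0 by rewrite (ca1 2 _ i2) /= oppr0 mul0r.
have c210 : c 2 1 0 = - c 2 0 1 by rewrite (ca1 2 _ i2) mulN1r.
have c3' i j : c i j 3 = 0 by apply: p3.
have c12 k : c 1 2 k = - c 2 1 k by apply: struct_constC.
have c32 k : c 3 2 k = 0 by rewrite struct_constC c23 oppr0.
pose p k := delta (plus_lift Q e`_k); pose m k := delta (minus_lift Q e`_k).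
have pE i j : \sum_(k < 4) conn_plus c (torsion_const Q e) j i k * p k = 0 :=
  plus_parallel oe ein i j.
have mE i j : \sum_(k < 4) conn_minus c (torsion_const Q e) i j k * m k = 0 :=
  minus_parallel oe ein i j.
have aI z : c 2 0 1 * z = 0 -> z = 0.
  by move/eqP; rewrite mulf_eq0 (negPf a0) => /eqP.
have nf := (h0, c02, c20, c21, c210, c3', c12, c23, c32, struct_constC Q e 2 0,
  bracket_eq0 (struct_constC Q e)).
have p1 : p 1 = 0.
  apply: aI; have := pE 0 2; rewrite sum_ord4 /conn_plus !nf => /= e0; lra.
have p0 : p 0 = 0.
  apply: aI; have := pE 1 2; rewrite sum_ord4 /conn_plus !nf => /= e0; lra.
have m1 : m 1 = 0.
  apply: aI; have := mE 2 0; rewrite sum_ord4 /conn_minus !nf => /= e0; lra.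
have m0 : m 0 = 0.
  apply: aI; have := mE 2 1; rewrite sum_ord4 /conn_minus !nf => /= e0; lra.
have [d0 d0'] := divergence_eq0 oe (i := 0) p0 m0.
have [d1 d1'] := divergence_eq0 oe (i := 1) p1 m1.
split=> //.
by split=> //; rewrite lieC ?l30 ?l31 oppr0.
Qed.

End Perp23Frame.
Lemma perpD X Y : perp X -> perp Y -> perp (X + Y).
Proof. by move=> pX pY U V; rewrite linearDr /= pX pY addr0. Qed.

Lemma exists_e2_frame (e : 4.-tuple g) :
  orthonormal_basis Q e -> perp e`_2 -> perp e`_3 ->
  (forall X Y : g, lie X Y = 0) \/
  exists e' : 4.-tuple g, orthonormal_basis Q e' /\ exists2 a, 0 < a & e2_frame Q e' a.
Proof.
move=> oe p2 p3; have [l01 l23 [l20 l21] [l30 l31]] := perp23_lie oe p2 p3.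
pose n := struct_const Q e 2 0 1; pose b := struct_const Q e 3 0 1.
have [nb0|nbN0] := eqVneq (n ^+ 2 + b ^+ 2) 0.
  have := nb0; move/eqP; rewrite paddr_eq0 ?sqr_ge0 // !sqrf_eq0.
  by move=> /andP[/eqP n0 /eqP b0]; left; apply: perp23_abelian n0 b0.
have G22 : G e`_2 e`_2 = 1 by apply: (frameG oe 2 2).
have G33 : G e`_3 e`_3 = 1 by apply: (frameG oe 3 3).
have G23 : G e`_2 e`_3 = 0 by apply: (frameG oe 2 3).
have G32 : G e`_3 e`_2 = 0 by apply: (frameG oe 3 2).
(* The maps ad e_2 and ad e_3 are [n] and [b] times the same rotation, so the combination [Z] is
   central and [U] is orthogonal to it; normalised, they replace e_2 and e_3. *)
pose U := n *: e`_2 + b *: e`_3; pose Z := - b *: e`_2 + n *: e`_3.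
have pU : perp U by apply: perpD; apply: perpZ.
have pZ : perp Z by apply: perpD; apply: perpZ.
have nz X : G X X = n ^+ 2 + b ^+ 2 -> X != 0.
  by move=> XX; apply: contraNneq nbN0 => X0; rewrite -XX X0 linear0l.
have GUU : G U U = n ^+ 2 + b ^+ 2.
  rewrite /U !(linearDl, linearDr) /= !(linearZl_LR, linearZr_LR) /=.
  by rewrite G22 G33 G23 G32; ring.
have GZZ : G Z Z = n ^+ 2 + b ^+ 2.
  rewrite /Z !(linearDl, linearDr) /= !(linearZl_LR, linearZr_LR) /=.
  by rewrite G22 G33 G23 G32; ring.
have GUZ : G U Z = 0.
  rewrite /U /Z !(linearDl, linearDr) /= !(linearZl_LR, linearZr_LR) /=.
  by rewrite G22 G33 G23 G32; ring.
have lieZ i : lie Z e`_i = - b *: lie e`_2 e`_i + n *: lie e`_3 e`_i.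
  by rewrite lieC /Z linearD !linearZ /= opprD -!scalerN -!lieC.
have Z0 : forall Y, lie Z Y = 0.
  apply: (lie_frame_eq0 oe); apply: forall_ord4; rewrite lieZ.
  - by rewrite l20 l30 !scalerA -/n -/b -scalerDl mulNr mulrC addNr scale0r.
  - by rewrite l21 l31 !scalerA -/n -/b -scalerDl !mulNr !mulrN opprK mulrC subrr scale0r.
  - by rewrite liexx lieC l23 oppr0 !scaler0 addr0.
  - by rewrite liexx l23 !scaler0 addr0.
have [||||e' [oe' e'2 e'3]] := @frame_with2 2 3 (unit_vector Q U) (unit_vector Q Z).
- by [].
- exact: unit_vectorP (nz _ GUU).
- exact: unit_vectorP (nz _ GZZ).
- by rewrite linearZl_LR linearZr_LR /= GUZ !mulr0.
have p2' : perp e'`_2 by rewrite e'2; apply: perpZ.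
have p3' : perp e'`_3 by rewrite e'3; apply: perpZ.
have c3 i j : struct_const Q e' 3 i j = 0.
  by rewrite /struct_const e'3 lieC /unit_vector linearZ /= lieC Z0 oppr0 scaler0 oppr0 linear0l.
have [a0|a0] := eqVneq (struct_const Q e' 2 0 1) 0.
  by left; apply: perp23_abelian oe' p2' p3' a0 (c3 0 1).
right; have [a_gt0|a_le0] := ltP 0 (struct_const Q e' 2 0 1).
  exists e'; split=> //; exists (struct_const Q e' 2 0 1) => //.
  exact: e2_outcome oe' p2' p3' a0 (c3 0 1).
(* Exchanging the first two vectors reverses the orientation of the rotation plane and makes the
   coefficient positive. *)
pose s : {perm 'I_4} := tperm 0 1; pose f := [tuple e'`_(s i) | i < 4].
have fE (i : 'I_4) : f`_i = e'`_(s i) by rewrite -tnth_nth tnth_mktuple.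
have f0 : f`_0 = e'`_1 by rewrite [LHS](fE 0) tpermL.
have f1 : f`_1 = e'`_0 by rewrite [LHS](fE 1) tpermR.
have f2 : f`_2 = e'`_2 by rewrite [LHS](fE 2) tpermD.
have f3 : f`_3 = e'`_3 by rewrite [LHS](fE 3) tpermD.
have of_ : orthonormal_basis Q f.
  apply: orthonormal_basis4 => // i j.
  by rewrite !fE (frameG oe') (inj_eq perm_inj).
have fa : struct_const Q f 2 0 1 = - struct_const Q e' 2 0 1.
  by rewrite -(@frame_skew e' oe' 2 p2' 0 1) /struct_const f0 f1 f2.
exists f; split=> //; exists (struct_const Q f 2 0 1).
  by rewrite fa oppr_gt0 lt_neqAle a0.
apply: e2_outcome; rewrite ?f2 ?f3 ?fa ?oppr_eq0 //.
by rewrite /struct_const f0 f1 f3; apply: (c3 1 0).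
Qed.

Lemma einstein_frame_classification : exists2 e : 4.-tuple g, orthonormal_basis Q e &
  [\/ (forall X Y : g, lie X Y = 0) /\ (forall X Y Z, H X Y Z = 0),
      (forall X Y Z, H X Y Z = 0) /\ (exists2 a, 0 < a & e2_frame Q e a) |
      exists a b eps, so3_frame Q a b eps e].
Proof.
have [e [oe p3 l30]] := exists_perp_frame.
have [h0|h0] := eqVneq (torsion_const Q e 0 1 2) 0; last first.
  by exists e => //; apply: Or33; do 3!eexists; apply: so3_outcome.
have [e' [oe' p2' p3']] := exists_perp2 oe p3 l30 h0.
have H0 := perp23_torsion oe' p2' p3'.
have [l0|[f [of_ fP]]] := exists_e2_frame oe' p2' p3'.
  by exists e' => //; apply: Or31.
by exists f => //; apply: Or32.
Qed.
End Classification.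

(** * Transport along isomorphisms *)

Section Push.
Variables (R : realType) (g h : lieAlgType R) (Q : gen_data g) (phi : 'Hom(g, h)).
Hypotheses (phi_bij : bijective phi)
  (phi_lie : forall X Y, phi (lie X Y) = lie (phi X) (phi Y)).
Local Notation psi := (phi^-1)%VF.

Lemma iso_invK X : psi (phi X) = X.
Proof. by apply: lker0_lfunK; apply/lker0P/bij_inj. Qed.

Lemma iso_Kinv Y : phi (psi Y) = Y.
Proof. by case: phi_bij => f _ fK; rewrite -(fK Y) iso_invK. Qed.

Lemma iso_inv_lie X Y : psi (lie X Y) = lie (psi X) (psi Y).
Proof. by rewrite -(iso_invK (lie _ _)) phi_lie !iso_Kinv. Qed.

Definition push_form (X Y : h) : R := metric Q (psi X) (psi Y).

Fact push_form_addl Y : zmod_morphism (push_form^~ Y).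
Proof. by move=> U V; rewrite /push_form linearB linearBl. Qed.
Fact push_form_addr X : zmod_morphism (push_form X).
Proof. by move=> U V; rewrite /push_form linearB linearBr. Qed.
Fact push_form_scalel Y : scalable_for *%R (push_form^~ Y).
Proof. by move=> a U; rewrite /push_form linearZ linearZl_LR. Qed.
Fact push_form_scaler X : scalable_for (idfun \; *%R) (push_form X).
Proof. by move=> a U; rewrite /push_form linearZ linearZr_LR. Qed.
HB.instance Definition _ := isBilinear.Build R h h R *%R (idfun \; *%R) push_form
  push_form_addl push_form_addr push_form_scalel push_form_scaler.
Fact push_form_sym X Y : push_form X Y = (-1) ^+ false * idfun (push_form Y X).
Proof. by rewrite expr0 mul1r; apply: metricC. Qed.
HB.instance Definition _ :=
  isHermitianSesquilinear.Build R h false idfun push_form push_form_sym.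

Definition push_metric : {symmetric h} := push_form.

Lemma push_nondegenerate : nondegenerate push_metric.
Proof.
rewrite /nondegenerate -subv0; apply/subvP => X /mem_orthovP X0.
have : psi X \in orthov (metric Q) {:g}.
  by apply/mem_orthovP => Y _; rewrite -(iso_invK Y); apply: X0; apply: memvf.
rewrite (eqP (metric_nondegenerate Q)) !memv0 => /eqP psi0.
by rewrite -(iso_Kinv X) psi0 linear0.
Qed.

Definition push_torsion : three_form h.
Proof.
exists (fun X Y Z => torsion Q (psi X) (psi Y) (psi Z)).
- by move=> Y Z a U V; rewrite linearP; apply: three_form_linear1.
- by move=> X Z a U V; rewrite linearP; apply: three_form_linear2.
- by move=> X Y a U V; rewrite linearP; apply: three_form_linear3.
- by move=> X Z; apply: three_form_alt12.
- by move=> X Y; apply: three_form_alt23.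
Defined.

Lemma push_closed X0 X1 X2 X3 : ce3 push_torsion X0 X1 X2 X3 = 0.
Proof.
by rewrite -[RHS](torsion_closed Q (psi X0) (psi X1) (psi X2) (psi X3)) /ce3 /= !iso_inv_lie.
Qed.

Definition push : gen_data h := GenData push_closed push_nondegenerate
  (linfun (fun u : gtangent h => divergence Q (psi u.1, (u.2 \o phi)%VF))).

Lemma push_divergence Y (xi : dual h) :
  divergence push (Y, xi) = divergence Q (psi Y, (xi \o phi)%VF).
Proof.
rewrite linfun_linearE // => a u v; rewrite -linearP; congr (divergence Q _).
by congr (_, _); rewrite /= ?linearP // comp_lfunDl comp_lfunZl.
Qed.

Lemma push_isomorphic : isomorphic Q push.
Proof.
exists phi => //; split=> //= [X Y|X Y Z|X xi].
- by rewrite /push_form !iso_invK.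
- by rewrite !iso_invK.
- rewrite [LHS]push_divergence iso_invK; congr (divergence Q (_, _)).
  by apply/lfunP => Y; rewrite !comp_lfunE iso_invK.
Qed.

Variable e : 4.-tuple g.
Hypothesis oe : orthonormal_basis Q e.
Variable f : 4.-tuple h.
Hypothesis fE : forall i : 'I_4, f`_i = phi e`_i.

Lemma push_frame : orthonormal_basis push f.
Proof.
have dim4 : \dim {:h} = 4.
  have /andP[be _] := oe; transitivity (\dim {:g}); last exact: size_basis be.
  rewrite -(limg_dim_eq (f := phi) (U := fullv)).
    congr (\dim _); apply/eqP; rewrite eqEsubv subvf andbT.
    by apply/subvP => Y _; rewrite -(iso_Kinv Y) memv_img ?memvf.
  by apply/eqP; rewrite capfv; apply/lker0P/bij_inj.
apply: orthonormal_basis4 => // i j.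
by rewrite [LHS]/(push_form _ _) /push_form !fE !iso_invK frameG.
Qed.

Lemma push_dual_basis (i : 'I_4) : (dual_basis f i \o phi)%VF = dual_basis e i.
Proof.
apply/lfunP => X; rewrite comp_lfunE (dual_basisE push_frame) (dual_basisE oe).
by rewrite [LHS]/(push_form _ _) /push_form fE !iso_invK.
Qed.

Lemma push_dual_basisE (i : 'I_4) Y : dual_basis f i Y = dual_basis e i (psi Y).
Proof. by rewrite -push_dual_basis comp_lfunE iso_Kinv. Qed.

Lemma push_vect (i : 'I_4) :
  divergence push (of_vect f`_i) = divergence Q (of_vect e`_i).
Proof.
rewrite [LHS]push_divergence fE iso_invK; congr (divergence Q (_, _)).
exact: comp_lfun0l.
Qed.

Lemma push_covect (i : 'I_4) : divergence push (of_covect (dual_basis f i)) =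
  divergence Q (of_covect (dual_basis e i)).
Proof. by rewrite [LHS]push_divergence push_dual_basis linear0. Qed.

Lemma push_e2_frame a : e2_frame Q e a -> e2_frame push f a.
Proof.
have f0 := fE 0; have f1 := fE 1; have f2 := fE 2; have f3 := fE 3.
rewrite /= in f0 f1 f2 f3.
move=> [l20 l21 [l01 l03 l13 l23] [d0 d1] [d0' d1']]; split=> /=.
- by rewrite f0 f1 f2 -phi_lie l20 linearZ.
- by rewrite f0 f1 f2 -phi_lie l21 linearZ.
- by rewrite f0 f1 f2 f3 -!phi_lie l01 l03 l13 l23 linear0.
- by split; [rewrite (push_vect 0) | rewrite (push_vect 1)].
- by rewrite !push_covect.
Qed.

Lemma push_so3_frame a b eps : so3_frame Q a b eps e -> so3_frame push a b eps f.
Proof.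
have f0 := fE 0; have f1 := fE 1; have f2 := fE 2; have f3 := fE 3.
rewrite /= in f0 f1 f2 f3.
move=> [[a0 eps1 _] [torE [[l01 l12 l20 [l23 l31 l03]] [bN0 b0]]]].
split; [split=> //; exact: push_frame|split; [|split; [|split]]].
- move=> X Y Z; rewrite [LHS]torE; congr (_ * \det _).
  apply/matrixP => i j; rewrite !mxE.
  case: i => [[|[|[|//]]] i3] /=; rewrite push_dual_basisE;
  by case: j => [[|[|[|//]]] j3].
- split; rewrite ?f0 ?f1 ?f2 ?f3 -?phi_lie ?l01 ?l12 ?l20 ?linearZ //.
  by rewrite l23 l31 l03 !linearZ linear0.
- move=> /bN0[d0 d]; split; first by rewrite (push_vect 0) push_covect.
  move=> u us; apply/eqP; rewrite -memv_ker; move: u us; apply/subvP/span_subvP.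
  pose s := [:: of_vect e`_1; of_vect e`_2; of_covect (dual_basis e 1);
    of_covect (dual_basis e 2)].
  have ds i : (i < 4)%N -> divergence Q s`_i = 0.
    by move=> i4; apply/d/memv_span/mem_nth.
  move=> u; rewrite !inE memv_ker => /or4P[]/eqP->; apply/eqP.
  + by rewrite (push_vect 1); apply: (ds 0%N).
  + by rewrite (push_vect 2); apply: (ds 1%N).
  + by rewrite push_covect; apply: (ds 2%N).
  + by rewrite push_covect; apply: (ds 3%N).
- move=> /b0[d0 d1 d2].
  by rewrite (push_vect 0) (push_vect 1) (push_vect 2) !push_covect.
Qed.
End Push.

(** * Lie isomorphisms from matching bracket tables *)

Section FrameIso.
Variables (R : realType) (g : lieAlgType R) (Q : gen_data g) (e : 4.-tuple g).
Hypothesis oe : orthonormal_basis Q e.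
Variables (h : lieAlgType R) (f : 4.-tuple h) (kappa : h -> 'I_4 -> R).
Hypotheses (kappaE : forall Y, Y = \sum_(i < 4) kappa Y i *: f`_i)
  (kappaf : forall (k : 'I_4 -> R) i, kappa (\sum_(j < 4) k j *: f`_j) i = k i)
  (lief : forall phi : 'Hom(g, h), (forall i : 'I_4, f`_i = phi e`_i) ->
    forall i j : 'I_4, lie f`_i f`_j = phi (lie e`_i e`_j)).

(** The coordinates [kappa] express that [f] is a basis. The bracket tables live on different spaces
    and can only be compared through a linear map taking one frame to the other; that map is built
    in this proof, so [lief] quantifies over all of them. *)
Lemma frame_iso : exists phi : 'Hom(g, h), [/\ bijective phi,
  forall X Y, phi (lie X Y) = lie (phi X) (phi Y) & forall i : 'I_4, f`_i = phi e`_i].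
Proof.
pose F X := \sum_(i < 4) metric Q X e`_i *: f`_i.
have F_lin : linear F.
  move=> a X Y; rewrite /F scaler_sumr -big_split; apply: eq_bigr => i _ /=.
  by rewrite linearPl scalerDl scalerA.
pose phi : 'Hom(g, h) := linfun F; have phiE X : phi X = F X by apply: linfun_linearE.
have phie (i : 'I_4) : f`_i = phi e`_i.
  rewrite phiE /F (bigD1 i) //= frameG // eqxx scale1r big1 ?addr0 // => j /negPf ji.
  by rewrite frameG // eq_sym ji scale0r.
exists phi; split=> //.
  exists (fun Y => \sum_i kappa Y i *: e`_i) => X.
    rewrite [RHS](frame_exp oe); apply: eq_bigr => i _.
    by rewrite phiE /F (kappaf (fun i => metric Q X e`_i)).
  rewrite phiE [RHS]kappaE; apply: eq_bigr => i _.
  by rewrite (metric_span oe).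
have phil (i j : 'I_4) : phi (lie e`_i e`_j) = lie (phi e`_i) (phi e`_j).
  by rewrite -!phie -lief.
have lieF W Y : lie (phi W) Y = \sum_(i < 4) metric Q W e`_i *: lie (phi e`_i) Y.
  rewrite lieC (phiE W) linear_sum -sumrN; apply: eq_bigr => i _.
  by rewrite linearZ /= -scalerN -lieC phie.
move=> X Y; rewrite (lie_expand2 oe) linear_sum lieF; apply: eq_bigr => i _.
rewrite linear_sum lieC (lieF Y) -sumrN scaler_sumr; apply: eq_bigr => j _.
by rewrite linearZ /= phil -scalerN -lieC scalerA.
Qed.
End FrameIso.

Lemma abelian_outcome (R : realType) (g : lieAlgType R) (Q : gen_data g)
    (e : 4.-tuple g) : orthonormal_basis Q e -> riemannian Q ->
  (forall X Y : g, lie X Y = 0) -> (forall X Y Z, torsion Q X Y Z = 0) ->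
  exists2 Q' : gen_data (R4 R), family_abelian Q' & isomorphic Q Q'.
Proof.
move=> oe pos lie0 tor0.
pose f : 4.-tuple (R4 R) := [tuple delta_mx 0 i | i < 4].
have fE (i : 'I_4) : f`_i = delta_mx 0 i :> 'rV[R]_4 by rewrite -tnth_nth tnth_mktuple.
have [|k i|phi _ i j|phi [phi_bij phi_lie phi_f]] := @frame_iso _ _ _ _ oe (R4 R) f
    (fun Y i => (Y : 'rV_4) 0 i).
- move=> Y; rewrite [LHS](row_sum_delta (Y : 'rV_4)).
  by apply: eq_bigr => i _; rewrite fE.
- rewrite (eq_bigr (fun j => k j *: (delta_mx 0 j : R4 R))) => [|j _]; last by rewrite fE.
  transitivity ((\sum_j (\row_j k j) 0 j *: delta_mx 0 j : 'rV[R]_4) 0 i); last first.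
    by rewrite -row_sum_delta mxE.
  rewrite [in RHS](eq_bigr (fun j => k j *: delta_mx 0 j : 'rV[R]_4)) // => j _.
  by rewrite mxE.
- by rewrite lie0 linear0.
exists (push Q phi_bij phi_lie); last exact: push_isomorphic.
split=> [X X0|X Y Z]; last exact: tor0.
by apply: pos; apply: contraNneq X0 => X0; rewrite -(iso_Kinv phi_bij X) X0 linear0.
Qed.

(** * The models *)

Lemma forall_ord3 (P : 'I_3 -> Prop) : P 0 -> P 1 -> P 2 -> forall i, P i.
Proof.
move=> P0 P1 P2 [[|[|[|//]]] i3].
- by rewrite (_ : Ordinal _ = 0) //; apply: val_inj.
- by rewrite (_ : Ordinal _ = 1) //; apply: val_inj.
- by rewrite (_ : Ordinal _ = 2) //; apply: val_inj.
Qed.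

(** * The model so(3) + R *)

Section So3Model.
Variable R : realType.
Implicit Types x y z t : R.

(** The matrix of the cross product with (x, y, z); the commutator becomes the cross product in
    [so3v_lie]. *)
Definition so3_mx x y z : 'M[R]_3 :=
  \matrix_(i, j) (nth [::] [:: [:: 0; - z; y]; [:: z; 0; - x]; [:: - y; x; 0]] i)`_j.

Lemma so3_mx_in x y z : so3_mx x y z \in so_space R 3.
Proof.
rewrite mem_so; apply/eqP/matrixP; do 2![apply: forall_ord3];
  by rewrite !mxE /= ?opprK ?oppr0.
Qed.

Lemma so3_mxP (A : 'M[R]_3) : A \in so_space R 3 -> A = so3_mx (A 2 1) (A 0 2) (A 1 0).
Proof.
rewrite mem_so => /eqP/matrixP tA.
have Aij i j : A j i = - A i j by have := tA i j; rewrite !mxE.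
have Aii i : A i i = 0.
  by apply/eqP; rewrite -[_ == _](mulrn_eq0 _ 2) mulr2n {1}Aij addNr.
apply/matrixP; do 2![apply: forall_ord3]; rewrite !mxE /= ?Aii //.
Qed.

Definition so3v x y z t : so3R R := (vsproj _ (so3_mx x y z), t).

Lemma so3v_val x y z t : vsval (so3v x y z t).1 = so3_mx x y z.
Proof. by rewrite vsprojK ?so3_mx_in. Qed.

Lemma so3vP (Y : so3R R) : let A := vsval Y.1 in
  Y = so3v (A 2 1) (A 0 2) (A 1 0) Y.2.
Proof.
case: Y => Y t /=; congr (_, _); apply: subvs_inj.
by rewrite vsprojK ?so3_mx_in // -so3_mxP // subvsP.
Qed.

Lemma so3vD x y z t x' y' z' t' :
  so3v x y z t + so3v x' y' z' t' = so3v (x + x') (y + y') (z + z') (t + t').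
Proof.
congr (_, _); apply: subvs_inj; rewrite linearD /= !vsprojK ?so3_mx_in //.
by apply/matrixP; do 2![apply: forall_ord3]; rewrite !mxE /=; ring.
Qed.

Lemma so3vZ a x y z t : a *: so3v x y z t = so3v (a * x) (a * y) (a * z) (a * t).
Proof.
congr (_, _); apply: subvs_inj; rewrite linearZ /= !vsprojK ?so3_mx_in //.
by apply/matrixP; do 2![apply: forall_ord3]; rewrite !mxE /=; ring.
Qed.

Lemma so3v0 : so3v 0 0 0 0 = 0.
Proof. by rewrite -[RHS](scale0r (so3v 0 0 0 0)) so3vZ !mulr0. Qed.

Lemma so3v_lie x y z t x' y' z' t' : lie (so3v x y z t) (so3v x' y' z' t') =
  so3v (y * z' - z * y') (z * x' - x * z') (x * y' - y * x') 0.
Proof.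
congr (_, _).
apply: subvs_inj; rewrite [LHS](vsval_sub_mxcomm (@mxcomm_so R 3)).
rewrite (so3v_val x y z t) (so3v_val x' y' z' t') vsprojK ?so3_mx_in // /mxcomm.
apply/matrixP; do 2![apply: forall_ord3];
  by rewrite !mxE !big_ord_recl !big_ord0 !mxE /=; ring.
Qed.

Lemma so3_outcome_model (g : lieAlgType R) (Q : gen_data g) (e : 4.-tuple g) a b eps :
  so3_frame Q a b eps e ->
  exists2 Q' : gen_data (so3R R), family_so3 Q' & isomorphic Q Q'.
Proof.
move=> fr; have [[a0 eps1 oe] [_ [[l01 l12 l20 [l23 l31 l03]] _]]] := fr.
pose r := eps * a; have r0 : r != 0.
  by rewrite mulf_neq0 //; case: eps1 => ->; rewrite ?oppr_eq0 oner_eq0.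
(* Scaling the standard generators by [r] multiplies their bracket constants by [r]. The last vector
   acts as [b] times the first standard generator, so it is sent to that element plus a central one;
   this explains the correction by [b] in the first entry of [kappa]. *)
pose f : 4.-tuple (so3R R) :=
  [tuple so3v r 0 0 0; so3v 0 r 0 0; so3v 0 0 r 0; so3v b 0 0 1].
pose kappa (Y : so3R R) (i : 'I_4) : R := let A := vsval Y.1 in
  [:: (A 2 1 - b * Y.2) / r; A 0 2 / r; A 1 0 / r; Y.2 : R]`_i.
have sumf (k : 'I_4 -> R) : \sum_(i < 4) k i *: f`_i =
    so3v (r * k 0 + b * k 3) (r * k 1) (r * k 2) (k 3).
  by rewrite sum_ord4 /= !so3vZ !so3vD; congr so3v; ring.
have f0 : f`_0 = so3v r 0 0 0 by []. have f1 : f`_1 = so3v 0 r 0 0 by [].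
have f2 : f`_2 = so3v 0 0 r 0 by []. have f3 : f`_3 = so3v b 0 0 1 by [].
have [|k|phi fphi|phi [phi_bij phi_lie phi_f]] := @frame_iso _ _ _ _ oe (so3R R) f kappa.
- by move=> Y; rewrite sumf {1}(so3vP Y) /kappa /=; congr so3v; field.
- by rewrite sumf; apply: forall_ord4; rewrite /kappa /= ?vsprojK ?so3_mx_in // ?mxE /=; field.
- have g0 := fphi 0; have g1 := fphi 1; have g2 := fphi 2; have g3 := fphi 3.
  rewrite /= in g0 g1 g2 g3.
  move=> i j; apply/eqP; rewrite -subr_eq0; apply/eqP; move: i j.
  apply: (skew_ord4 (F := fun i j => lie f`_i f`_j - phi (lie e`_i e`_j))) => [i j|i||||||] /=.
  + by rewrite (lieC f`_i) (lieC e`_i) linearN opprB opprK addrC.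
  + by rewrite !liexx linear0 subrr.
  + rewrite l01 linearZ /= -g2 !so3v_lie so3vZ; apply/eqP; rewrite subr_eq0.
    by apply/eqP; congr so3v; rewrite /r; ring.
  + rewrite (lieC e`_2) (lieC f`_2) l20 linearN linearZ /= -g1 !so3v_lie so3vZ opprK.
    apply/eqP; rewrite addrC subr_eq0.
    by apply/eqP; congr so3v; rewrite /r; ring.
  + by rewrite l03 linear0 subr0 so3v_lie -[RHS]so3v0; congr so3v; ring.
  + rewrite l12 linearZ /= -g0 !so3v_lie so3vZ; apply/eqP; rewrite subr_eq0.
    by apply/eqP; congr so3v; rewrite /r; ring.
  + rewrite (lieC e`_3) (lieC f`_3) l31 linearN linearZ /= -g2 !so3v_lie so3vZ opprK.
    apply/eqP; rewrite addrC subr_eq0.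
    by apply/eqP; congr so3v; rewrite /r; ring.
  + rewrite l23 linearZ /= -g1 !so3v_lie so3vZ; apply/eqP; rewrite subr_eq0.
    by apply/eqP; congr so3v; rewrite /r; ring.
exists (push Q phi_bij phi_lie); last exact: push_isomorphic.
by exists a, b, eps, f; apply: (push_so3_frame phi_bij phi_lie oe phi_f fr).
Qed.
End So3Model.

(** * The model e(2) + R *)

Section E2Model.
Variable R : realType.
Implicit Types w x y t a : R.

(** Here [w] is the angular velocity and (x, y) the translation part. *)
Definition e2_mx w x y : 'M[R]_(2 + 1) :=
  \matrix_(i, j) (nth [::] [:: [:: 0; - w; x]; [:: w; 0; y]; [:: 0; 0; 0]] i)`_j.

Lemma e2_mx_in w x y : e2_mx w x y \in euc_space R 2.
Proof.
rewrite mem_euc; apply/andP; split; apply/eqP/matrixP.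
  by move=> [[|[|//]] i2] [[|[|//]] j2]; rewrite !mxE /= ?opprK ?oppr0.
by move=> [[|//] i1] [[|[|[|//]]] j3]; rewrite !mxE.
Qed.

Lemma e2_mxP (A : 'M[R]_(2 + 1)) : A \in euc_space R 2 ->
  A = e2_mx (A (1 : 'I_3) (0 : 'I_3)) (A (0 : 'I_3) (2 : 'I_3)) (A (1 : 'I_3) (2 : 'I_3)).
Proof.
rewrite mem_euc => /andP[/eqP/matrixP tA /eqP/matrixP dA].
have Aij (i j : 'I_2) : A (lshift 1 j) (lshift 1 i) = - A (lshift 1 i) (lshift 1 j).
  by have := tA i j; rewrite !mxE.
have Aii (i : 'I_2) : A (lshift 1 i) (lshift 1 i) = 0.
  by apply/eqP; rewrite -[_ == _](mulrn_eq0 _ 2) mulr2n {1}Aij addNr.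
have A2 j : A (rshift 2 0) j = 0 by have := dA 0 j; rewrite !mxE.
have i0 : lshift 1 (0 : 'I_2) = (0 : 'I_3) by apply: val_inj.
have i1 : lshift 1 (1 : 'I_2) = (1 : 'I_3) by apply: val_inj.
have i2 : rshift 2 (0 : 'I_1) = (2 : 'I_3) by apply: val_inj.
have A01 := Aij 1 0; have A00 := Aii 0; have A11 := Aii 1.
rewrite i0 i1 in A01 A00 A11; rewrite i2 in A2.
apply/matrixP; do 2![apply: forall_ord3]; rewrite !mxE //=.
Qed.

Definition e2v w x y t : e2R R := (vsproj _ (e2_mx w x y), t).

Lemma e2v_val w x y t : vsval (e2v w x y t).1 = e2_mx w x y.
Proof. by rewrite vsprojK ?e2_mx_in. Qed.

Lemma e2vP (Y : e2R R) : let A := vsval Y.1 in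
  Y = e2v (A (1 : 'I_3) (0 : 'I_3)) (A (0 : 'I_3) (2 : 'I_3)) (A (1 : 'I_3) (2 : 'I_3)) Y.2.
Proof.
case: Y => Y t /=; congr (_, _); apply: subvs_inj.
by rewrite vsprojK ?e2_mx_in // -e2_mxP // subvsP.
Qed.

Lemma e2vD w x y t w' x' y' t' :
  e2v w x y t + e2v w' x' y' t' = e2v (w + w') (x + x') (y + y') (t + t').
Proof.
congr (_, _); apply: subvs_inj; rewrite linearD /= !vsprojK ?e2_mx_in //.
by apply/matrixP; do 2![apply: forall_ord3]; rewrite !mxE /=; ring.
Qed.

Lemma e2vZ a w x y t : a *: e2v w x y t = e2v (a * w) (a * x) (a * y) (a * t).
Proof.
congr (_, _); apply: subvs_inj; rewrite linearZ /= !vsprojK ?e2_mx_in //.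
by apply/matrixP; do 2![apply: forall_ord3]; rewrite !mxE /=; ring.
Qed.

Lemma e2v0 : e2v 0 0 0 0 = 0.
Proof. by rewrite -[RHS](scale0r (e2v 0 0 0 0)) e2vZ !mulr0. Qed.

Lemma e2v_lie w x y t w' x' y' t' : lie (e2v w x y t) (e2v w' x' y' t') =
  e2v 0 (w' * y - w * y') (w * x' - w' * x) 0.
Proof.
congr (_, _).
apply: subvs_inj; rewrite [LHS](vsval_sub_mxcomm (@mxcomm_euc R 2)).
rewrite (e2v_val w x y t) (e2v_val w' x' y' t') vsprojK ?e2_mx_in // /mxcomm.
apply/matrixP; do 2![apply: forall_ord3];
  by rewrite !mxE !big_ord_recl !big_ord0 !mxE /=; ring.
Qed.

Lemma e2_outcome_model (g : lieAlgType R) (Q : gen_data g) (e : 4.-tuple g) a :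
  orthonormal_basis Q e -> (forall X Y Z, torsion Q X Y Z = 0) -> 0 < a ->
  e2_frame Q e a ->
  exists2 Q' : gen_data (e2R R), family_e2 Q' & isomorphic Q Q'.
Proof.
move=> oe tor0 a_gt0 fr; have [l20 l21 [l01 l03 l13 l23] _ _] := fr.
have a0 : a != 0 by rewrite gt_eqF.
pose f : 4.-tuple (e2R R) :=
  [tuple e2v 0 1 0 0; e2v 0 0 1 0; e2v a 0 0 0; e2v 0 0 0 1].
pose kappa (Y : e2R R) (i : 'I_4) : R := let A := vsval Y.1 in
  [:: A (0 : 'I_3) (2 : 'I_3); A (1 : 'I_3) (2 : 'I_3);
      A (1 : 'I_3) (0 : 'I_3) / a; Y.2 : R]`_i.
have sumf (k : 'I_4 -> R) : \sum_(i < 4) k i *: f`_i = e2v (a * k 2) (k 0) (k 1) (k 3).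
  by rewrite sum_ord4 /= !e2vZ !e2vD; congr e2v; ring.
have f0 : f`_0 = e2v 0 1 0 0 by []. have f1 : f`_1 = e2v 0 0 1 0 by [].
have f2 : f`_2 = e2v a 0 0 0 by []. have f3 : f`_3 = e2v 0 0 0 1 by [].
have [|k|phi fphi|phi [phi_bij phi_lie phi_f]] := @frame_iso _ _ _ _ oe (e2R R) f kappa.
- by move=> Y; rewrite sumf {1}(e2vP Y) /kappa /=; congr e2v; field.
- by rewrite sumf; apply: forall_ord4; rewrite /kappa /= ?vsprojK ?e2_mx_in // ?mxE /=; field.
- have g0 := fphi 0; have g1 := fphi 1; have g2 := fphi 2; have g3 := fphi 3.
  rewrite /= in g0 g1 g2 g3.
  move=> i j; apply/eqP; rewrite -subr_eq0; apply/eqP; move: i j.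
  apply: (skew_ord4 (F := fun i j => lie f`_i f`_j - phi (lie e`_i e`_j))) => [i j|i||||||] /=.
  + by rewrite (lieC f`_i) (lieC e`_i) linearN opprB opprK addrC.
  + by rewrite !liexx linear0 subrr.
  + by rewrite l01 linear0 subr0 e2v_lie -[RHS]e2v0; congr e2v; ring.
  + rewrite (lieC e`_2) (lieC f`_2) l20 linearN linearZ /= -g1 !e2v_lie e2vZ opprK.
    apply/eqP; rewrite addrC subr_eq0.
    by apply/eqP; congr e2v; ring.
  + by rewrite l03 linear0 subr0 e2v_lie -[RHS]e2v0; congr e2v; ring.
  + rewrite (lieC e`_2) (lieC f`_2) l21 linearN linearZ /= -g0 !e2v_lie e2vZ opprK.
    apply/eqP; rewrite addrC subr_eq0.
    by apply/eqP; congr e2v; ring.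
  + by rewrite l13 linear0 subr0 e2v_lie -[RHS]e2v0; congr e2v; ring.
  + by rewrite l23 linear0 subr0 e2v_lie -[RHS]e2v0; congr e2v; ring.
exists (push Q phi_bij phi_lie); last exact: push_isomorphic.
split=> [X Y Z|]; first exact: tor0.
exists f; first exact: (push_frame phi_bij phi_lie oe phi_f).
by exists a => //; apply: (push_e2_frame phi_bij phi_lie oe phi_f fr).
Qed.
End E2Model.

(** * The models are Einstein *)

Section EqArrays.
Variables (R : realFieldType) (n : nat) (c c' h h' : 'I_n -> 'I_n -> 'I_n -> R).
Hypotheses (cE : forall i j k, c i j k = c' i j k) (hE : forall i j k, h i j k = h' i j k).

Lemma eq_conn_plus j i k : conn_plus c h j i k = conn_plus c' h' j i k.
Proof. by rewrite /conn_plus !cE hE. Qed.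

Lemma eq_conn_minus i j k : conn_minus c h i j k = conn_minus c' h' i j k.
Proof. by rewrite /conn_minus !cE hE. Qed.

Lemma eq_ricci i j : ricci c h i j = ricci c' h' i j.
Proof.
apply: eq_bigr => k _; apply: eq_bigr => l _.
by rewrite eq_conn_plus eq_conn_minus.
Qed.
End EqArrays.

Section Converse.
Variables (R : realType) (g : lieAlgType R) (Q : gen_data g).
Local Notation G := (metric Q).
Local Notation delta := (divergence Q).
Variable e : 4.-tuple g.
Hypothesis oe : orthonormal_basis Q e.

(** The families e(2) and so(3) prescribe an orthonormal basis; positivity of the metric follows
    since g(X, X) is the sum of the squares of the coordinates of X. *)
Lemma frame_riemannian : riemannian Q.
Proof.
move=> X X0; have GE : G X X = \sum_(i < 4) G X e`_i ^+ 2.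
  rewrite {2}(frame_exp oe X) linear_sumr; apply: eq_bigr => i _.
  by rewrite linearZr_LR.
rewrite lt_neqAle GE sumr_ge0 ?andbT => [|i _]; last exact: sqr_ge0.
apply: contraNneq X0 => /esym G0; rewrite (frame_exp oe X) big1 // => i _.
have /eqP : G X e`_i ^+ 2 = 0 by apply: (psumr_eq0P _ G0) => // j _; apply: sqr_ge0.
by rewrite sqrf_eq0 => /eqP ->; rewrite scale0r.
Qed.

Lemma frame_dim : \dim {:g} = 4.
Proof. by have /andP[be _] := oe; exact: size_basis be. Qed.

Variables (l m b s : R).

(** The bracket L (x * y) on the first three vectors with L = diag(l, l, m), and a rotation of speed
    [b] for ad of the last one. The parameters (l, m, b, s) are (0, 0, 0, 0) for R^4, (a, 0, 0, 0)
    for e(2) + R and (eps a, eps a, b, a) for so(3) + R. *)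
Definition model_str (i j k : 'I_4) : R :=
  (nth [::] (nth [::] [::
    [:: [:: 0; 0; 0; 0]; [:: 0; 0; m; 0]; [:: 0; - l; 0; 0]; [:: 0; 0; 0; 0]];
    [:: [:: 0; 0; - m; 0]; [:: 0; 0; 0; 0]; [:: l; 0; 0; 0]; [:: 0; 0; - b; 0]];
    [:: [:: 0; l; 0; 0]; [:: - l; 0; 0; 0]; [:: 0; 0; 0; 0]; [:: 0; b; 0; 0]];
    [:: [:: 0; 0; 0; 0]; [:: 0; 0; b; 0]; [:: 0; - b; 0; 0]; [:: 0; 0; 0; 0]]] i) j)`_k.

Definition model_tor (i j k : 'I_4) : R :=
  s * ((i == 0)%:R * ((j == 1)%:R * (k == 2)%:R - (j == 2)%:R * (k == 1)%:R)
    - (j == 0)%:R * ((i == 1)%:R * (k == 2)%:R - (i == 2)%:R * (k == 1)%:R)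
    + (k == 0)%:R * ((i == 1)%:R * (j == 2)%:R - (i == 2)%:R * (j == 1)%:R)).

(** For L = diag(l, l, m) one has N = diag(m, m, 2 l - m), and the hypotheses say that its adjugate
    is s^2. *)
Lemma model_ricci : m ^+ 2 = s ^+ 2 -> m * (l + l - m) = s ^+ 2 ->
  forall i j, ricci model_str model_tor i j = 0.
Proof.
move=> e1 e2; do 2![apply: forall_ord4]; rewrite /ricci !sum_ord4 /conn_plus /conn_minus
  /model_str /model_tor /=.
all: lra.
Qed.

Lemma model_strC i j k : model_str j i k = - model_str i j k.
Proof.
move: i j k; do 3![apply: forall_ord4]; by rewrite /model_str /= ?opprK ?oppr0.
Qed.

Lemma model_strii i k : model_str i i k = 0.
Proof. by move: i k; do 2![apply: forall_ord4]. Qed.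

Lemma model_plus (p : 'I_4 -> R) :
  (m + s) * p 0 = 0 -> (m + s) * p 1 = 0 -> (m + s) * p 2 = 0 ->
  (l + l - m + s) * p 0 = 0 -> (l + l - m + s) * p 1 = 0 ->
  b * p 1 = 0 -> b * p 2 = 0 ->
  forall i j, \sum_k conn_plus model_str model_tor j i k * p k = 0.
Proof.
move=> e0 e1 e2 e3 e4 e5 e6; do 2![apply: forall_ord4];
  rewrite sum_ord4 /conn_plus /model_str /model_tor /=.
all: lra.
Qed.

Lemma model_minus (p : 'I_4 -> R) :
  (m - s) * p 0 = 0 -> (m - s) * p 1 = 0 -> (m - s) * p 2 = 0 ->
  (l + l - m - s) * p 0 = 0 -> (l + l - m - s) * p 1 = 0 ->
  b * p 1 = 0 -> b * p 2 = 0 ->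
  forall i j, \sum_k conn_minus model_str model_tor i j k * p k = 0.
Proof.
move=> e0 e1 e2 e3 e4 e5 e6; do 2![apply: forall_ord4];
  rewrite sum_ord4 /conn_minus /model_str /model_tor /=.
all: lra.
Qed.

Hypothesis lie_e :
  [/\ lie e`_0 e`_1 = m *: e`_2, lie e`_1 e`_2 = l *: e`_0, lie e`_2 e`_0 = l *: e`_1 &
  [/\ lie e`_2 e`_3 = b *: e`_1, lie e`_3 e`_1 = b *: e`_2 & lie e`_0 e`_3 = 0]].

Lemma model_strE i j k : struct_const Q e i j k = model_str i j k.
Proof.
have [l01 l12 l20 [l23 l31 l03]] := lie_e.
suff lieE : forall i j : 'I_4,
    lie e`_i e`_j - \sum_(k < 4) model_str i j k *: e`_k = 0.
  by rewrite /struct_const -[lie _ _](subrK (\sum_(k < 4) model_str i j k *: e`_k)) lieE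
    add0r (metric_span oe).
apply: (skew_ord4 (F := fun i j : 'I_4 =>
    lie e`_i e`_j - \sum_(k < 4) model_str i j k *: e`_k)) => [{}i {}j|{}i||||||].
- rewrite lieC (eq_bigr (fun k : 'I_4 => - (model_str i j k *: e`_k))) => [|{}k _].
    by rewrite sumrN opprK opprB addrC.
  by rewrite model_strC scaleNr.
- by rewrite liexx sub0r big1 ?oppr0 // => {}k _; rewrite model_strii scale0r.
- by rewrite sum_ord4 /model_str /= l01 !scale0r !(addr0, add0r) subrr.
- by rewrite sum_ord4 /model_str /= lieC l20 !scale0r !(addr0, add0r) scaleNr subrr.
- by rewrite sum_ord4 /model_str /= l03 !scale0r !(addr0, add0r) oppr0.
- by rewrite sum_ord4 /model_str /= l12 !scale0r !(addr0, add0r) subrr.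
- by rewrite sum_ord4 /model_str /= lieC l31 !scale0r !(addr0, add0r) scaleNr subrr.
- by rewrite sum_ord4 /model_str /= l23 !scale0r !(addr0, add0r) subrr.
Qed.

Lemma model_einstein (p := fun i : 'I_4 => delta (plus_lift Q e`_i))
    (n := fun i : 'I_4 => delta (minus_lift Q e`_i)) :
  (forall X Y Z, torsion Q X Y Z =
    s * wedge3 (dual_basis e 0) (dual_basis e 1) (dual_basis e 2) X Y Z) ->
  m ^+ 2 = s ^+ 2 -> m * (l + l - m) = s ^+ 2 ->
  [/\ (m + s) * p 0 = 0, (m + s) * p 1 = 0 & (m + s) * p 2 = 0] ->
  [/\ (m - s) * n 0 = 0, (m - s) * n 1 = 0 & (m - s) * n 2 = 0] ->
  (l + l - m + s) * p 0 = 0 /\ (l + l - m + s) * p 1 = 0 ->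
  (l + l - m - s) * n 0 = 0 /\ (l + l - m - s) * n 1 = 0 ->
  [/\ b * p 1 = 0, b * p 2 = 0, b * n 1 = 0 & b * n 2 = 0] ->
  gen_einstein_riemannian4 Q.
Proof.
move=> torE e1 e2 [p0 p1 p2] [n0 n1 n2] [p0' p1'] [n0' n1'] [bp1 bp2 bn1 bn2].
have tor_model i j k : torsion_const Q e i j k = model_tor i j k.
  have G_ord (a : 'I_4) : (G e`_a e`_0 = (a == 0)%:R) * (G e`_a e`_1 = (a == 1)%:R) *
      (G e`_a e`_2 = (a == 2)%:R).
    by split; [split|]; [exact: (frameG oe a 0)|exact: (frameG oe a 1)
      |exact: (frameG oe a 2)].
  by rewrite /torsion_const torE (wedge3E oe) !G_ord.
split; [exact: frame_dim | exact: frame_riemannian |].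
apply: (frame_gen_einstein oe) => i j.
- by rewrite (eq_ricci model_strE tor_model) model_ricci.
- rewrite (eq_bigr (fun k => conn_plus model_str model_tor j i k * p k)).
    exact: model_plus.
  by move=> k _; rewrite (eq_conn_plus model_strE tor_model).
- rewrite (eq_bigr (fun k => conn_minus model_str model_tor i j k * n k)).
    exact: model_minus.
  by move=> k _; rewrite (eq_conn_minus model_strE tor_model).
Qed.
End Converse.

Lemma family_abelian_einstein (R : realType) (Q : gen_data (R4 R)) :
  family_abelian Q -> gen_einstein_riemannian4 Q.
Proof.
move=> [pos tor0]; have dim4 : \dim {: R4 R} = 4 by rewrite dimvf /= dim_matrix.
have [|e oe _] := @extend_frame _ _ Q dim4 pos set0 (fun=> 0).
  by move=> i j; rewrite inE.
have lie0 (X Y : R4 R) : lie X Y = 0 by [].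
apply: (@model_einstein _ _ Q e oe 0 0 0 0);
  rewrite ?expr0n /= ?addr0 ?subr0 ?mul0r //.
  by rewrite !scale0r.
by move=> X Y Z; rewrite tor0 mul0r.
Qed.

Lemma e2_frame_einstein (R : realType) (g : lieAlgType R) (Q : gen_data g)
    (e : 4.-tuple g) a :
  orthonormal_basis Q e -> (forall X Y Z, torsion Q X Y Z = 0) -> e2_frame Q e a ->
  gen_einstein_riemannian4 Q.
Proof.
move=> oe tor0 [l20 l21 [l01 l03 l13 l23] [d0 d1] [d0' d1']].
have p0 : divergence Q (plus_lift Q e`_0) = 0.
  by rewrite [LHS](divergence_plus oe 0) d0 d0' addr0.
have p1 : divergence Q (plus_lift Q e`_1) = 0.
  by rewrite [LHS](divergence_plus oe 1) d1 d1' addr0.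
have n0 : divergence Q (minus_lift Q e`_0) = 0.
  by rewrite [LHS](divergence_minus oe 0) d0 d0' subr0.
have n1 : divergence Q (minus_lift Q e`_1) = 0.
  by rewrite [LHS](divergence_minus oe 1) d1 d1' subr0.
apply: (@model_einstein _ _ Q e oe a 0 0 0);
  rewrite ?expr0n /= ?addr0 ?subr0 ?mul0r ?p0 ?p1 ?n0 ?n1 ?mulr0 //.
  rewrite !scale0r; split=> //; first by rewrite lieC l21 scaleNr opprK.
  by split=> //; rewrite lieC l13 oppr0.
by move=> X Y Z; rewrite tor0 mul0r.
Qed.

Lemma so3_frame_einstein (R : realType) (g : lieAlgType R) (Q : gen_data g)
    (e : 4.-tuple g) a b eps :
  so3_frame Q a b eps e -> gen_einstein_riemannian4 Q.
Proof.
move=> [[a0 eps1 oe] [torE [[l01 l12 l20 l3] [bN0 b0]]]].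
have r2 : (eps * a) ^+ 2 = a ^+ 2.
  by rewrite exprMn; case: eps1 => ->; rewrite ?sqrrN expr1n mul1r.
have eps2 : eps ^+ 2 = 1 by case: eps1 => ->; rewrite ?sqrrN expr1n.
pose v (i : 'I_4) := divergence Q (of_vect e`_i).
pose w (i : 'I_4) := divergence Q (of_covect (dual_basis e i)).
have bv : [/\ b * v 1 = 0, b * v 2 = 0, b * w 1 = 0 & b * w 2 = 0].
  have [->|/bN0[_ d]] := eqVneq b 0; first by rewrite !mul0r.
  pose s := [:: of_vect e`_1; of_vect e`_2; of_covect (dual_basis e 1);
    of_covect (dual_basis e 2)].
  have ds i : (i < 4)%N -> b * divergence Q s`_i = 0.
    by move=> i4; rewrite d ?mulr0 //; apply/memv_span/mem_nth.
  by split; [exact: (ds 0%N) | exact: (ds 1%N) | exact: (ds 2%N) | exact: (ds 3%N)].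
(* The relation of the case b = 0 also holds for b nonzero, where both sides vanish for the second
   and third vectors; this merges the two cases. *)
have [v0 v1 v2] : [/\ v 0 = - eps * w 0, v 1 = - eps * w 1 & v 2 = - eps * w 2].
  have [b00|bn0] := eqVneq b 0; first by have [] := b0 b00.
  have [d0 _] := bN0 bn0; have [bv1 bv2 bw1 bw2] := bv.
  have bI x : b * x = 0 -> x = 0.
    by move/eqP; rewrite mulf_eq0 (negPf bn0) => /eqP.
  by rewrite (bI _ bv1) (bI _ bv2) (bI _ bw1) (bI _ bw2) !mulr0.
(* For either sign of [eps] one factor is zero; eps^2 = 1 treats both signs together. *)
have ep (x : R) : (eps * a + a) * (- eps * x + x) = 0.
  by transitivity (a * x * (1 - eps ^+ 2)); [ring | rewrite eps2 subrr mulr0].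
have em (x : R) : (eps * a - a) * (- eps * x - x) = 0.
  by transitivity (a * x * (1 - eps ^+ 2)); [ring | rewrite eps2 subrr mulr0].
have pE (i : 'I_4) : divergence Q (plus_lift Q e`_i) = v i + w i := divergence_plus oe i.
have nE (i : 'I_4) : divergence Q (minus_lift Q e`_i) = v i - w i := divergence_minus oe i.
have [bv1 bv2 bw1 bw2] := bv.
apply: (@model_einstein _ _ Q e oe (eps * a) (eps * a) b a) => //;
  rewrite ?addrK -?expr2 // ?pE ?nE.
- by rewrite v0 v1 v2 !ep.
- by rewrite v0 v1 v2 !em.
- by rewrite v0 v1 !ep.
- by rewrite v0 v1 !em.
- by rewrite !mulrDr !mulrN bv1 bv2 bw1 bw2 oppr0 !addr0.
Qed.

Theorem theorem3p4 (R : realType) :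
  (forall (g : lieAlgType R) (Q : gen_data g), gen_einstein_riemannian4 Q ->
     [\/ exists2 Q' : gen_data (R4 R), family_abelian Q' & isomorphic Q Q',
         exists2 Q' : gen_data (e2R R), family_e2 Q' & isomorphic Q Q' |
         exists2 Q' : gen_data (so3R R), family_so3 Q' & isomorphic Q Q'])
  /\
  [/\ forall Q' : gen_data (R4 R),
        family_abelian Q' -> gen_einstein_riemannian4 Q',
      forall Q' : gen_data (e2R R),
        family_e2 Q' -> gen_einstein_riemannian4 Q' &
      forall Q' : gen_data (so3R R),
        family_so3 Q' -> gen_einstein_riemannian4 Q'].
Proof.
split; last first.
  split=> Q'; first exact: family_abelian_einstein.
    by move=> [tor0 [e oe [a _ fr]]]; apply: e2_frame_einstein oe tor0 fr.
  by move=> [a [b [eps [e fr]]]]; apply: so3_frame_einstein fr.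
move=> g Q [dim4 pos ein]; have [e oe] := einstein_frame_classification dim4 pos ein.
case=> [[lie0 tor0]|[tor0 [a a_gt0 fr]]|[a [b [eps fr]]]].
- by apply: Or31; apply: abelian_outcome oe pos lie0 tor0.
- by apply: Or32; apply: e2_outcome_model oe tor0 a_gt0 fr.
- by apply: Or33; apply: so3_outcome_model fr.
Qed.
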